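(* Let $\beta$ be the Traveling Salesman constant for the unit square, i.e. the constant such that, for independent uniform random variables $X_1, X_2, \dots$ on $[0,1]^2$, $\lim_{n\to\infty} \frac{L(X_1,\dots,X_n)}{\sqrt{n}} = \beta$ almost surely. Then \[ \beta \geq \frac{5}{8} + \frac{19}{10368}. \]
   Context: For points $x_1,\dots,x_n \in [0,1]^2$, $L(x_1,\dots,x_n)$ denotes the length of the shortest Traveling Salesman tour (closed tour visiting all the points) through $x_1,\dots,x_n$, where distances are Euclidean, $d(x,y) = \Vert x-y\Vert_2$. By a theorem of Beardwood, Halton and Hammersley (1959), there exists a (deterministic) constant $\beta$ such that, for i.i.d. uniform random variables $X_1, X_2, \dots$ on $[0,1]^2$, $L(X_1,\dots,X_n)/\sqrt{n} \to \beta$ almost surely as $n \to \infty$. *)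

(* Defs.v *)
From HB Require Import structures.
From mathcomp Require Import all_boot all_order all_algebra all_fingroup finmap.
From mathcomp Require Import all_classical all_reals all_analysis.

Set Implicit Arguments.
Unset Strict Implicit.
Unset Printing Implicit Defensive.

Import Order.TTheory GRing.Theory Num.Theory.
Import numFieldNormedType.Exports.

Local Open Scope classical_set_scope.
Local Open Scope ring_scope.

(* [R * R] carries the sup norm in the library, hence an explicit distance. *)
Definition euclidean_dist (R : realType) (x y : R * R) : R :=
  Num.sqrt ((x.1 - y.1) ^+ 2 + (x.2 - y.2) ^+ 2).

(* [ordS] is the cyclic successor, so the last leg returns to the start. *)
Definition closed_tour_length (R : realType) (n : nat) (x : 'I_n -> R * R)
    (s : 'S_n) : R :=
  \sum_(i < n) euclidean_dist (x (s i)) (x (s (ordS i))).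

(* The identity order is the (redundant) unit of the minimum, which is thus a
   minimum over all visiting orders, also for [n = 0] (where it is 0). *)
Definition shortest_tour_length (R : realType) (n : nat) (x : 'I_n -> R * R)
    : R :=
  \big[Num.min/closed_tour_length x 1%g]_(s : 'S_n) closed_tour_length x s.

Definition unit_square (R : realType) : set (R * R) :=
  `[0, 1]%classic `*` `[0, 1]%classic.
Arguments unit_square R : clear implicits.

(* No normalisation: the unit square has area 1. *)
Definition uniform_on_unit_square (d : measure_display) (T : measurableType d)
    (R : realType) (P : probability T R) (X : {RV P >-> (R * R)%type}) : Prop :=
  forall A : set (R * R), measurable A ->
    distribution P X A =
    (lebesgue_measure \x lebesgue_measure)%E (A `&` unit_square R).

Definition mutually_independent (d d' : measure_display)
    (T : measurableType d) (T' : measurableType d') (R : realType)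
    (P : probability T R) (I : choiceType) (X : I -> {RV P >-> T'}) : Prop :=
  forall (J : {fset I}) (A : I -> set T'), (forall i, measurable (A i)) ->
    P (\bigcap_(i in [set` J]) X i @^-1` A i) =
    (\prod_(i <- J) P (X i @^-1` A i))%E.

(* Main.v *)
Require Import Defs.
From mathcomp Require Import all_boot all_order all_algebra all_fingroup finmap.
From mathcomp Require Import all_classical all_reals all_analysis.
From mathcomp Require Import measurable_realfun ring lra zify.

Set Implicit Arguments.
Unset Strict Implicit.
Unset Printing Implicit Defensive.

Import Order.TTheory GRing.Theory Num.Theory.
Import numFieldNormedType.Exports.

Local Open Scope classical_set_scope.
Local Open Scope ring_scope.

(** A tour enters and leaves every vertex, so twice its length is the sum over
    the vertices [v] of the two tour edges at [v], which is at least the sum of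
    the distances [d1 v + d2 v] from [v] to its two nearest neighbours. For [n]
    uniform points the number of points within [x / sqrt n] of a given one is
    asymptotically Poisson with mean [pi x ^ 2], so [d1] and [d2] have means
    [1 / 2] and [3 / 4] in units of [1 / sqrt n]; this gives
    [(1 / 2) * (1 / 2 + 3 / 4) = 5 / 8].

    The extra term comes from configurations in which not every vertex can use its
    two nearest neighbours. Let [B] and [C] be the nearest and second nearest
    points of [v], at distances [a] and [b], with [2 a < b], and let all others be
    further than [r] from [v], where [r >= 2 a + b]. If [v] is not joined to both
    [B] and [C], the tour loses at [v]; if it is, [B] cannot be joined to [C],
    since the tour has no triangle, and it loses at [B]. In either case the two
    edges at [v] and at [B] exceed the nearest-neighbour bound by at least
    [r - 2 a - b] (lemma [twin_excess]). As [2 a < b] makes [v] the strict nearest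
    neighbour of [B], each vertex is charged at most twice, and the loss summed
    over all such [v] is at most twice the total excess ([tour_lower_bound]).

    Both [d1 + d2] and the loss are integrals over a radius of indicators saying
    how many points lie in discs and annuli around [v]. With [u = pi x ^ 2] the
    mean number of points within [x], the means are integrals of [exp (- u)],
    [u exp (- u)] and of a multiple of [u ^ 2 exp (- u)]; the multiple is the area,
    in the coordinates [(a ^ 2, b ^ 2)], of the region [2 a < b], [2 a + b < 1],
    namely [1 / 48]. The resulting constant is [5 / 8 + 1 / 512], and [1 / 512]
    exceeds [19 / 10368] by six percent. This margin allows the region to be
    replaced by a staircase of [50] products of annuli.

    Only finitely many events are needed. The radius runs over multiples of a mesh
    [1 / (N q)] with [n = N ^ 2], and the point [v] over the cells of the grid of
    the same mesh. Once the cell of [v] is fixed, isolation and twins follow from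
    conditions imposed separately on each point (its cell, disc, annulus, or the
    complement of a disc), with discs enlarged by twice the mesh
    ([sum_isolated_le], [sum_isolated_but_one_le], [sum_twinned_le]); mutual
    independence then gives the probabilities as finite products. Letting [N] grow
    with [q] fixed bounds [beta] below by a Riemann sum ([resolution_bound]), using
    dominated convergence for the truncated counts ([mean_limit]). Letting [q] grow
    turns the Riemann sum into the Gaussian integral ([riemann_limit]). *)

(** * Two nearest neighbours and twins: a deterministic bound on a tour *)

Lemma sum_steps_below (R : realDomainType) (h d : R) (K : nat) :
  0 <= h -> 0 <= d ->
  \sum_(k < K) (k.+1%:R * h < d)%R%:R * h <= d.
Proof.
move=> h0 d0.
suff /andP[] : (\sum_(k < K) (k.+1%:R * h < d)%R%:R * h <= d) &&
   (\sum_(k < K) (k.+1%:R * h < d)%R%:R * h <= K%:R * h) by [].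
elim: K => [|K /andP[IH1 IH2]]; first by rewrite !big_ord0 d0 mul0r lexx.
rewrite !big_ord_recr /=; case: (ltP (K.+1%:R * h) d) => H /=.
  by rewrite !mul1r; apply/andP; split; move: H; rewrite -natr1; nra.
by rewrite mul0r addr0 IH1 /= -natr1; nra.
Qed.

Lemma sum_steps_above (R : realDomainType) (h x : R) (m : nat) :
  0 <= h -> x <= m%:R * h ->
  \sum_(k < m) (x <= k%:R * h)%R%:R * h <= m%:R * h - x.
Proof.
move=> h0; elim: m => [|m IH] xm.
  by rewrite big_ord0; lra.
rewrite big_ord_recr /=; case: (leP x (m%:R * h)) => H /=.
  by have := IH H; rewrite -natr1; lra.
rewrite mul0r addr0 big1 ?subr_ge0// => i _.
rewrite leNgt (le_lt_trans _ H) ?mul0r//.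
by rewrite ler_wpM2r// ler_nat ltnW.
Qed.

Section tour_bound.
Variables (R : realDomainType) (V : finType) (D : V -> V -> R).
Hypothesis D_ge0 : forall u v, 0 <= D u v.
Hypothesis D_sym : forall u v, D u v = D v u.
Hypothesis D_triangle : forall u v w, D u w <= D u v + D v w.
Variables (h : R) (K : nat).
Hypothesis h_ge0 : 0 <= h.

Definition isolated (v : V) (r : R) : bool :=
  [forall w, (w != v) ==> (r < D v w)].

Definition isolated_but_one (v : V) (r : R) : bool :=
  [exists j, forall w, (w != v) && (w != j) ==> (r < D v w)].

(** The factor [2] in [2 * D v B < D v C] makes [v] the strict nearest neighbour
    of [B]; the bound [r] on [2 * D v B + D v C] is where the loss caused by the
    twins [v] and [B] starts to count, and [r'] the radius that it reaches. *)
Definition twin_at (v B C : V) (r r' : R) : bool :=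
  [&& B != v, C != v, B != C, (2 * D v B < D v C) && (2 * D v B + D v C <= r)
    & [forall w, [&& w != v, w != B & w != C] ==> (r' < D v w)]].

Definition twinned (v : V) (r r' : R) : bool :=
  [exists B, exists C, twin_at v B C r r'].

(** A lower Riemann sum, with [K] steps of width [h], of the sum of the distances
    from [v] to its two nearest neighbours: the nearest one is further than [r]
    exactly when [v] is isolated, the second one when [v] is isolated but for one
    vertex. *)
Definition two_neighbour_sum (v : V) : R :=
  \sum_(k < K) ((isolated v (k.+1%:R * h))%:R
              + (isolated_but_one v (k.+1%:R * h))%:R) * h.

(** The loss [r - 2 * D v B - D v C] as a Riemann sum over [r]. The two radii of
    [twinned] differ by one step, which compensates the rounding at both ends. *)
Definition twin_sum (v : V) : R :=
  \sum_(k < K) (twinned v (k%:R * h) (k.+1%:R * h))%:R * h.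

(** At each radius, isolation puts both [j] and [l] outside, and isolation but for
    one vertex puts at least one of them outside. *)
Lemma two_neighbour_sum_le (v j l : V) : j != v -> l != v -> j != l ->
  two_neighbour_sum v <= D v j + D v l.
Proof.
move=> jv lv jl.
apply: le_trans (lerD (sum_steps_below K h_ge0 (D_ge0 v j))
                      (sum_steps_below K h_ge0 (D_ge0 v l))).
rewrite -big_split /=; apply: ler_sum => k _.
rewrite -mulrDl ler_wpM2r//; set r := _ * h.
case: (boolP (isolated v r)) => [/forallP iso|_] /=.
  have /implyP /(_ jv) -> := iso j; have /implyP /(_ lv) -> := iso l.
  by rewrite lerD2l lern1 leq_b1.
rewrite add0r; case: (boolP (isolated_but_one v r)) => [/existsP[w /forallP iso]|_].
  have [wj|wj] := eqVneq w j.
    have /implyP := iso l; rewrite lv wj eq_sym jl => /(_ isT) -> /=.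
    by rewrite lerDr.
  have /implyP := iso j; rewrite jv eq_sym wj => /(_ isT) -> /=.
  by rewrite lerDl.
by rewrite addr_ge0.
Qed.

Variables (succ pred : V -> V).
Hypothesis succK : cancel succ pred.
Hypothesis predK : cancel pred succ.
Hypothesis succ1 : forall v, succ v != v.
Hypothesis succ2 : forall v, succ (succ v) != v.
Hypothesis succ3 : forall v, succ (succ (succ v)) != v.

Definition excess (v : V) : R := D v (succ v) + D v (pred v) - two_neighbour_sum v.

Lemma pred_neq (v : V) : pred v != v.
Proof. by have := succ1 (pred v); rewrite predK eq_sym. Qed.

Lemma succ_neq_pred (v : V) : succ v != pred v.
Proof. by have := succ2 (pred v); rewrite predK. Qed.

Lemma excess_ge0 (v : V) : 0 <= excess v.
Proof.
rewrite subr_ge0; apply: two_neighbour_sum_le; first exact: succ1.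
  exact: pred_neq.
exact: succ_neq_pred.
Qed.

(** If [v] lies between [B] and [C] on the tour, a step from [B] to [C] would
    close a tour of three vertices. *)
Lemma tour_no_triangle (v B C w : V) :
  [|| (succ v == B) && (pred v == C) | (succ v == C) && (pred v == B)] ->
  w = succ B \/ w = pred B -> w != C.
Proof.
case/orP => /andP[/eqP sv /eqP pv] [->|->]; apply/eqP.
- move=> sBC; have /negP := succ3 v; apply.
  by rewrite sv sBC -pv predK.
- by rewrite -sv succK => vC; have := pred_neq v; rewrite pv vC eqxx.
- by rewrite -pv predK => vC; have := succ1 v; rewrite sv vC eqxx.
- move=> sBC; have /negP := succ3 (succ v); apply.
  by rewrite sv -sBC predK -pv predK sv -sBC -pv.
Qed.

Lemma other_neighbour (u v : V) : u = succ v \/ u = pred v ->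
  exists2 w, (w = succ u \/ w = pred u) /\ w != v &
    D u (succ u) + D u (pred u) = D u v + D u w.
Proof.
case=> ->.
- exists (succ (succ v)); last by rewrite succK addrC.
  by split; [left | exact: succ2].
- exists (pred (pred v)); last by rewrite predK.
  split; first by right.
  by have := succ2 (pred (pred v)); rewrite !predK eq_sym.
Qed.

(** If [v] is not between [B] and [C], one of its edges is longer than [r'] and
    the other at least [D v B]. Otherwise the second edge at [B] leads outside,
    hence is longer than [r' - D v B], while the nearest-neighbour bound at [B] is
    at most [D B v + D B C], and [D B C <= D v B + D v C]. *)
Lemma twin_excess (v B C : V) (r r' : R) : twin_at v B C r r' -> r <= r' ->
  r' - (2 * D v B + D v C) <= excess v + excess B.
Proof.
move=> /and5P[Bv Cv BC /andP[aab abr] /forallP far] rr'.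
have a0 := D_ge0 v B.
have LB : two_neighbour_sum B <= D v B + (D v B + D v C).
  apply: le_trans (@two_neighbour_sum_le B v C _ _ _) _.
  - by rewrite eq_sym.
  - by rewrite eq_sym.
  - by rewrite eq_sym.
  rewrite (D_sym B v) lerD2l; apply: le_trans (D_triangle B v C) _.
  by rewrite (D_sym B v).
have LA : two_neighbour_sum v <= D v B + D v C by exact: two_neighbour_sum_le.
have eA := excess_ge0 v; have eB := excess_ge0 B.
have H : [|| (succ v == B) && (pred v == C) | (succ v == C) && (pred v == B)]
   \/ r' + D v B <= D v (succ v) + D v (pred v).
  have far' w : w != v -> w != B -> w != C -> r' < D v w.
    by move=> *; have /implyP := far w; apply; apply/and3P; split.
  have := succ_neq_pred v; have sv := succ1 v; have pv := pred_neq v.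
  have [->|sB] := eqVneq (succ v) B.
    rewrite eq_sym => pB; have [->|pC] := eqVneq (pred v) C; first by left.
    by right; have := far' _ pv pB pC; lra.
  have [->|sC] := eqVneq (succ v) C.
    rewrite eq_sym => pC; have [->|pB] := eqVneq (pred v) B; first by left.
    by right; have := far' _ pv pB pC; lra.
  move=> _; right; have rs := far' _ sv sB sC.
  have [->|pB] := eqVneq (pred v) B; first by lra.
  have [->|pC] := eqVneq (pred v) C; first by lra.
  by have := far' _ pv pB pC; lra.
case: H => [tri|H]; last by rewrite /excess in eA eB *; lra.
have : B = succ v \/ B = pred v.
  by case/orP: tri => /andP[/eqP sv /eqP pv]; [left|right].
move=> /other_neighbour[w [wB wv] eE].
have wC := tour_no_triangle tri wB.
have wNB : w != B by case: wB => ->; [exact: succ1|exact: pred_neq].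
have /implyP := far w; rewrite wv wNB wC => /(_ isT) rw.
have := D_triangle v B w.
by move: eA eB; rewrite /excess eE (D_sym B v); lra.
Qed.

Lemma twin_nearest (v B C w : V) (r r' : R) : twin_at v B C r r' -> r <= r' ->
  w != B -> w != v -> D B v < D B w.
Proof.
move=> /and5P[Bv Cv BC /andP[aab abr] /forallP far] rr' wB wv.
have a0 := D_ge0 v B; rewrite (D_sym B v).
have := D_triangle v B w.
have [->|wC] := eqVneq w C; first by lra.
by have /implyP := far w; rewrite wv wB wC => /(_ isT); lra.
Qed.

(** The vertices [B'] and [C'] lie in the disc in which [B] and [C] are the only
    other vertices, and their order is forced by [2 * D v B < D v C]. *)
Lemma twin_at_uniq (v B C B' C' : V) (r r' s s' : R) :
  twin_at v B C r r' -> twin_at v B' C' s s' -> s <= r' -> B = B' /\ C = C'.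
Proof.
move=> /and5P[Bv Cv BC /andP[aab abr] /forallP far] /and5P[B'v C'v BC' /andP[aab' abr'] _] sr'.
have a0 := D_ge0 v B; have a0' := D_ge0 v B'.
have near w : w != v -> D v w <= s -> (w == B) || (w == C).
  move=> wv ws; apply/negP => /negP; rewrite negb_or => wBC.
  have /implyP := far w; rewrite wv wBC => /(_ isT); lra.
have /orP[/eqP EB|/eqP EB] : (B' == B) || (B' == C) by apply: near => //; lra.
all: have /orP[/eqP EC|/eqP EC] : (C' == B) || (C' == C) by apply: near => //; lra.
- by move: BC'; rewrite EB EC eqxx.
- by [].
- by exfalso; move: aab'; rewrite EB EC; clear EB EC; lra.
- by move: BC'; rewrite EB EC eqxx.
Qed.

(** All levels at which [v] is twinned have the same [B] and [C], so they lie
    between [2 * D v B + D v C] and the top level; [twin_excess] is applied at the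
    latter. *)
Lemma twin_sum_le (v : V) :
  twin_sum v = 0 \/ exists B, [/\ twin_sum v <= excess v + excess B &
    B != v /\ forall w, w != B -> w != v -> D B v < D B w].
Proof.
case: (boolP [exists k : 'I_K, twinned v (k%:R * h) (k.+1%:R * h)]); last first.
  move=> /existsPn none; left; rewrite /twin_sum big1// => k _.
  by rewrite (negbTE (none k)) mul0r.
move=> /existsP[k0 tk0]; right.
have [m tm mmax] := @arg_maxnP _ k0
  (fun k : 'I_K => twinned v (k%:R * h) (k.+1%:R * h)) (fun k => k : nat) tk0.
have /existsP[B /existsP[C tw]] := tm.
have rr' : m%:R * h <= m.+1%:R * h by rewrite ler_wpM2r// ler_nat.
exists B; split; last first.
  split; first by case/and5P: tw.
  by move=> w; exact: twin_nearest tw rr'.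
apply: le_trans (twin_excess tw rr').
set x := _ + D v C.
have xm : x <= m%:R * h by case/and5P: tw => _ _ _ /andP[].
apply: le_trans (sum_steps_above h_ge0 (le_trans xm rr')).
have mK : (m.+1 <= K)%N by [].
rewrite (big_ord_widen K (fun k => (x <= k%:R * h)%R%:R * h) mK).
rewrite [X in _ <= X]big_mkcond /=; apply: ler_sum => k _.
case: (boolP (twinned v (k%:R * h) (k.+1%:R * h))) => [tk|_]; last first.
  by rewrite mul0r; case: ifP => // _; rewrite mulr_ge0.
have km : (k <= m)%N by exact: mmax.
rewrite ltnS km ler_wpM2r//=.
have /existsP[B' /existsP[C' tk']] := tk.
have kh : k%:R * h <= m.+1%:R * h by rewrite ler_wpM2r// ler_nat; exact: leqW.
have [EB EC] := twin_at_uniq tw tk' kh.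
by case/and5P: tk'; rewrite /x EB EC => _ _ _ /andP[_ ->].
Qed.

(** The map sending a twinned [v] to [B] is injective, as [v] is the strict
    nearest neighbour of [B]. Hence every excess is charged at most twice. *)
Lemma sum_twin_sum_le : \sum_v twin_sum v <= (\sum_v excess v) *+ 2.
Proof.
have /choice[f fP] : forall v, exists B, twin_sum v = 0 \/
   twin_sum v <= excess v + excess B /\
   (B != v /\ forall w, w != B -> w != v -> D B v < D B w).
  move=> v; case: (twin_sum_le v) => [->|[B []]]; first by exists v; left.
  by exists B; right.
pose S := [set v | twin_sum v != 0]%SET.
have inS v : v \in S -> twin_sum v <= excess v + excess (f v) /\
   (f v != v /\ forall w, w != f v -> w != v -> D (f v) v < D (f v) w).
  by rewrite inE; case: (fP v) => // ->; rewrite eqxx.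
have finj : {in S &, injective f}.
  move=> u v uS vS fuv; apply/eqP/negPn/negP => uv.
  have [_ [fu nu]] := inS _ uS; have [_ [fv nv]] := inS _ vS.
  have := nu v; rewrite fuv eq_sym fv eq_sym => /(_ isT uv).
  have := nv u; rewrite -fuv eq_sym fu => /(_ isT uv).
  by move=> /lt_trans /[apply]; rewrite ltxx.
have -> : \sum_v twin_sum v = \sum_(v in S) twin_sum v.
  rewrite [RHS]big_mkcond; apply: eq_bigr => v _.
  by rewrite inE; case: eqP => //= ->.
apply: (@le_trans _ _ (\sum_(v in S) (excess v + excess (f v)))).
  by apply: ler_sum => v /inS[].
rewrite big_split mulr2n; apply: lerD.
  rewrite [leLHS]big_mkcond; apply: ler_sum => v _.
  by case: ifP => // _; exact: excess_ge0.
rewrite -(big_imset excess finj) /= [leLHS]big_mkcond; apply: ler_sum => v _.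
by case: ifP => // _; exact: excess_ge0.
Qed.

Theorem tour_lower_bound :
  \sum_v (2 * two_neighbour_sum v + twin_sum v) <= 4 * \sum_v D v (succ v).
Proof.
have E : \sum_v D v (pred v) = \sum_v D v (succ v).
  rewrite (reindex succ) /=; last by exists pred => v _.
  by apply: eq_bigr => v _; rewrite succK D_sym.
have := sum_twin_sum_le.
rewrite /excess !big_split /= E sumrN -mulr_sumr mulr2n; lra.
Qed.

End tour_bound.

(** * Euclidean tours *)

Lemma euclidean_dist_ge0 (R : realType) (x y : R * R) : 0 <= euclidean_dist x y.
Proof. exact: sqrtr_ge0. Qed.

Lemma euclidean_distC (R : realType) (x y : R * R) :
  euclidean_dist x y = euclidean_dist y x.
Proof. by rewrite /euclidean_dist; congr Num.sqrt; ring. Qed.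

Lemma euclidean_dist_leE (R : realType) (x y : R * R) (r : R) : 0 <= r ->
  (euclidean_dist x y <= r) = ((x.1 - y.1) ^+ 2 + (x.2 - y.2) ^+ 2 <= r ^+ 2).
Proof.
by move=> r0; rewrite -(ler_sqrt _ (sqr_ge0 r)) sqrtr_sqr ger0_norm.
Qed.

Lemma euclidean_dist_triangle (R : realType) (x y z : R * R) :
  euclidean_dist x z <= euclidean_dist x y + euclidean_dist y z.
Proof.
have sqE (u v : R * R) :
    euclidean_dist u v ^+ 2 = (u.1 - v.1) ^+ 2 + (u.2 - v.2) ^+ 2.
  by rewrite sqr_sqrtr// addr_ge0// sqr_ge0.
have d1 := euclidean_dist_ge0 x y; have d2 := euclidean_dist_ge0 y z.
rewrite euclidean_dist_leE ?addr_ge0// [leRHS]sqrrD !sqE.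
set a := x.1 - y.1; set b := x.2 - y.2.
set c := y.1 - z.1; set e := y.2 - z.2.
have -> : x.1 - z.1 = a + c by rewrite /a /c; ring.
have -> : x.2 - z.2 = b + e by rewrite /b /e; ring.
(* By the Cauchy-Schwarz inequality. *)
have CS : a * c + b * e <= euclidean_dist x y * euclidean_dist y z.
  apply: le_trans (ler_norm _) _.
  rewrite -(@ler_pXn2r _ 2)// ?nnegrE ?mulr_ge0// real_normK ?num_real//.
  rewrite exprMn !sqE -/a -/b -/c -/e.
  by have := sqr_ge0 (a * e - b * c); nra.
by rewrite -mulr_natl; nra.
Qed.

Section tour_of_permutation.
Variables (n : nat) (s : 'S_n).

Definition tour_succ (v : 'I_n) : 'I_n := s (ordS (s^-1%g v)).
Definition tour_pred (v : 'I_n) : 'I_n := s (ord_pred (s^-1%g v)).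

Lemma tour_succK : cancel tour_succ tour_pred.
Proof. by move=> v; rewrite /tour_pred permK ordSK permKV. Qed.

Lemma tour_predK : cancel tour_pred tour_succ.
Proof. by move=> v; rewrite /tour_succ permK ord_predK permKV. Qed.

Lemma iter_ordS_neq (j : nat) (i : 'I_n) : (0 < j < n)%N -> iter j (@ordS n) i != i.
Proof.
move=> /andP[j0 jn].
have E : (iter j (@ordS n) i : nat) = ((i + j) %% n)%N.
  elim: j {j0 jn} => [|j IH] /=; first by rewrite addn0 modn_small.
  by rewrite IH -addn1 modnDml addn1 addnS.
apply/eqP => /(congr1 (@nat_of_ord n)); rewrite E.
have [lt|ge] := ltnP (i + j) n.
  by rewrite modn_small//; lia.
have -> : (i + j = (i + j - n) + n)%N by lia.
by rewrite modnDr modn_small; have := ltn_ord i; lia.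
Qed.

Lemma iter_tour_succ_neq (j : nat) (v : 'I_n) :
  (0 < j < n)%N -> iter j tour_succ v != v.
Proof.
move=> jn; have -> : iter j tour_succ v = s (iter j (@ordS n) (s^-1%g v)).
  by elim: j {jn} => [|j IH] /=; rewrite ?permKV// IH /tour_succ permK.
by rewrite -{2}(permKV s v) (inj_eq perm_inj) iter_ordS_neq.
Qed.

Lemma closed_tour_lengthE (R : realType) (x : 'I_n -> R * R) :
  closed_tour_length x s = \sum_v euclidean_dist (x v) (x (tour_succ v)).
Proof.
rewrite [RHS](reindex s) /=; last by exists (s^-1)%g => v _; rewrite ?permK ?permKV.
by apply: eq_bigr => i _; rewrite /tour_succ permK.
Qed.

End tour_of_permutation.

Lemma shortest_tour_lower_bound (R : realType) (n K : nat) (x : 'I_n -> R * R) (h : R)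
    (D := fun u v => euclidean_dist (x u) (x v)) :
  (3 < n)%N -> 0 <= h ->
  \sum_v (2 * two_neighbour_sum D h K v + twin_sum D h K v)
    <= 4 * shortest_tour_length x.
Proof.
move=> n3 h0; rewrite [leRHS]mulrC -ler_pdivrMr//.
have bnd s : (\sum_v (2 * two_neighbour_sum D h K v + twin_sum D h K v)) / 4
    <= closed_tour_length x s.
  rewrite ler_pdivrMr// mulrC closed_tour_lengthE.
  apply: (@tour_lower_bound R _ D _ _ _ h K h0 _ (tour_pred s)).
  - by move=> u v; exact: euclidean_dist_ge0.
  - by move=> u v; exact: euclidean_distC.
  - by move=> u v w; exact: euclidean_dist_triangle.
  - exact: tour_succK.
  - exact: tour_predK.
  - by move=> v; apply: (@iter_tour_succ_neq _ s 1); lia.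
  - by move=> v; apply: (@iter_tour_succ_neq _ s 2); lia.
  - by move=> v; apply: (@iter_tour_succ_neq _ s 3); lia.
by apply: (big_ind (fun y => _ <= y)) => // a b; rewrite le_min => -> ->.
Qed.

(** * The area of a disc *)

Definition disc (R : realType) (z : R * R) (r : R) : set (R * R) :=
  [set p | euclidean_dist z p <= r].

Definition area (R : realType) : set (R * R) -> \bar R :=
  (@lebesgue_measure R \x @lebesgue_measure R)%E.

Lemma measurable_disc (R : realType) (z : R * R) (r : R) :
  measurable (disc z r).
Proof.
have mf : measurable_fun setT (fun p : R * R => euclidean_dist z p).
  apply: (measurableT_comp (continuous_measurable_fun (@sqrt_continuous R))) => //.
  have m1 : measurable_fun setT (fun p : R * R => z.1 - p.1).
    by apply: measurable_funB; [exact: measurable_cst|exact: measurable_fst].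
  have m2 : measurable_fun setT (fun p : R * R => z.2 - p.2).
    by apply: measurable_funB; [exact: measurable_cst|exact: measurable_snd].
  exact: measurable_funD (measurable_funX 2 m1) (measurable_funX 2 m2).
rewrite -[disc z r]setTI; have -> : disc z r =
   (fun p => euclidean_dist z p) @^-1` `]-oo, r]%classic.
  by apply/seteqP; split => p /=; rewrite in_itv.
exact: mf.
Qed.

(** The length of the vertical section of a disc; for [t < 0] the section is empty
    and the square root is [0]. *)
Lemma lebesgue_measure_sqr_le (R : realType) (c t : R) :
  lebesgue_measure [set y : R | (c - y) ^+ 2 <= t] = (2 * Num.sqrt t)%:E.
Proof.
have [t0|t0] := leP 0 t.
  have -> : [set y : R | (c - y) ^+ 2 <= t] = `[c - Num.sqrt t, c + Num.sqrt t]%classic.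
    apply/seteqP; split => y /=;
      by rewrite in_itv /= -ler_distlC -sqrtr_sqr (ler_sqrt _ t0).
  rewrite lebesgue_measure_itv /= lte_fin; case: ifPn => [_|].
    by rewrite -EFinB; congr EFin; ring.
  rewrite -leNgt => H; have := sqrtr_ge0 t => s0.
  by congr EFin; lra.
rewrite ltr0_sqrtr// mulr0; have -> : [set y : R | (c - y) ^+ 2 <= t] = set0.
  apply/seteqP; split => y //= H.
  by have := le_lt_trans (le_trans (sqr_ge0 _) H) t0; rewrite ltxx.
exact: measure0.
Qed.


(** The substitution [x = c + r * sin t] turns the integrand into
    [2 * r ^+ 2 * cos t ^+ 2], which has a primitive that is smooth up to the
    endpoints. *)
Lemma integral_semicircle (R : realType) (c r : R) : 0 < r ->
  (\int[lebesgue_measure]_(x in `[(c - r)%R, (c + r)%R])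
     (2 * Num.sqrt (r ^+ 2 - (c - x) ^+ 2))%:E)%E = (pi * r ^+ 2)%:E.
Proof.
move=> r0.
pose F (t : R) := c + r * sin t.
have F'E (t : R) : is_derive t (1 : R) F (r * cos t).
  by rewrite /F; apply: is_derive_eq; rewrite add0r mul1r.
have F' : derive1 F = (fun t => r * cos t).
  by apply/funext => t; rewrite derive1E; apply: derive_val.
have cF : continuous F by move=> t; apply/differentiable_continuous/derivable1_diffP/ex_derive.
have pi0 : (0 : R) < pi := pi_gt0 R.
have Fa : F (- (pi / 2)) = c - r by rewrite /F sinN sin_pihalf mulrN1.
have Fb : F (pi / 2) = c + r by rewrite /F sin_pihalf mulr1.
have cF' : continuous (fun t : R => r * cos t).
  by move=> t; apply: cvgMr; exact: continuous_cos.
rewrite -Fa -Fb integration_by_substitution_increasing; last first.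
- have cq : continuous (fun x : R => r ^+ 2 - (c - x) ^+ 2).
    by move=> x; apply/differentiable_continuous/derivable1_diffP/ex_derive.
  apply: continuous_subspaceT => x; apply: cvgM; first exact: cvg_cst.
  apply: (@continuous_comp _ _ _ (fun x => r ^+ 2 - (c - x) ^+ 2) (@Num.sqrt R)).
    exact: cq.
  exact: sqrt_continuous.
- split => //.
  + by apply: cvg_at_right_filter; exact: cF.
  + by apply: cvg_at_left_filter; exact: cF.
- by rewrite F'; apply/cvg_ex; eexists; apply: cvg_at_left_filter; exact: cF'.
- by rewrite F'; apply/cvg_ex; eexists; apply: cvg_at_right_filter; exact: cF'.
- by move=> x _; rewrite F'; exact: cF'.
- by move=> x y xI yI xy; rewrite /F ltrD2l ltr_pM2l// ltr_sin.
- lra.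
pose H (t : R) := r ^+ 2 * (t + sin t * cos t).
have H'E (t : R) : is_derive t (1 : R) H (2 * r ^+ 2 * cos t ^+ 2).
  rewrite /H; apply: is_derive_eq.
  rewrite /GRing.scale /=; have := cos2Dsin2 t; set C := cos t; set S := sin t.
  have -> : 2 * r ^+ 2 * C ^+ 2 = r ^+ 2 * (1 + (C ^+ 2 - (1 - C ^+ 2))) by ring.
  by move=> <-; ring.
have H' : derive1 H = (fun t => 2 * r ^+ 2 * cos t ^+ 2).
  by apply/funext => t; rewrite derive1E; apply: derive_val.
have cH : continuous H by move=> t; apply/differentiable_continuous/derivable1_diffP/ex_derive.
transitivity (\int[lebesgue_measure]_(t in `[(- (pi / 2))%R, (pi / 2)%R])
   (2 * r ^+ 2 * cos t ^+ 2)%:E)%E.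
  apply: eq_integral => t; rewrite inE /= in_itv/= => /cos_ge0_pihalf c0.
  rewrite fctE /= F' /F; congr EFin.
  have -> : r ^+ 2 - (c - (c + r * sin t)) ^+ 2 = (r * cos t) ^+ 2.
    by rewrite [RHS]exprMn cos2sin2; ring.
  rewrite sqrtr_sqr ger0_norm; last by rewrite mulr_ge0// ltW.
  ring.
rewrite (@continuous_FTC2 _ _ H); last 4 first.
- lra.
- apply: continuous_subspaceT => x.
  by apply/differentiable_continuous/derivable1_diffP/ex_derive.
- split => //.
  + by apply: cvg_at_right_filter; exact: cH.
  + by apply: cvg_at_left_filter; exact: cH.
- by move=> t _; rewrite H'.
by rewrite -EFinB /H sinN cosN sin_pihalf cos_pihalf; congr EFin; field.
Qed.

Lemma area_disc (R : realType) (z : R * R) (r : R) : 0 <= r ->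
  area (disc z r) = (pi * r ^+ 2)%:E.
Proof.
move=> r0; rewrite /area /product_measure1.
transitivity (\int[lebesgue_measure]_x
    (2 * Num.sqrt (r ^+ 2 - (z.1 - x) ^+ 2))%:E)%E.
  apply: eq_integral => x _ /=; rewrite -(lebesgue_measure_sqr_le z.2).
  congr (lebesgue_measure _); apply/seteqP; split => y.
    by move=> /xsectionP; rewrite /disc /= euclidean_dist_leE//= lerBrDl.
  by move=> H; apply/xsectionP; rewrite /disc /= euclidean_dist_leE//= -lerBrDl.
move: r0; rewrite le_eqVlt => /predU1P[<-|r0].
  rewrite expr0n mulr0 integral0_eq// => x _.
  by rewrite ler0_sqrtr ?mulr0// add0r oppr_le0 sqr_ge0.
rewrite -(integral_semicircle z.1 r0) [RHS]integral_mkcond.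
apply: eq_integral => x _; rewrite patchE; case: ifPn => //.
rewrite notin_setE /= in_itv /= => out.
rewrite ler0_sqrtr ?mulr0// subr_le0 -(real_normK (num_real (z.1 - x))).
rewrite (ler_pXn2r _ (ltW r0) (normr_ge0 _))// leNgt; apply/negP => xr; apply: out.
by rewrite -ler_distlC ltW.
Qed.

(** * Passing to the limit through means *)

Section mean.
Context (d : measure_display) (T : measurableType d) (R : realType)
  (P : probability T R).

Definition has_mean (f : T -> R) (m : R) : Prop :=
  P.-integrable setT (EFin \o f) /\ (\int[P]_t (f t)%:E = m%:E)%E.

Lemma has_mean_sum (I : Type) (s : seq I) (Q : pred I) (f : I -> T -> R) (m : I -> R) :
  (forall i, Q i -> has_mean (f i) (m i)) ->
  has_mean (fun t => \sum_(i <- s | Q i) f i t) (\sum_(i <- s | Q i) m i).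
Proof.
move=> H.
have E : EFin \o (fun t => \sum_(i <- s | Q i) f i t) =
    (fun t => (\sum_(i <- s | Q i) (f i t)%:E)%E).
  by apply/funext => t /=; rewrite sumEFin.
split.
  by rewrite E; apply: integrable_sum => // i /H[].
rewrite -[X in integral _ _ X]/(EFin \o (fun t => \sum_(i <- s | Q i) f i t)) E.
elim: s {E} => [|i s IH].
  by rewrite big_nil; under eq_integral do rewrite big_nil; rewrite integral0.
rewrite big_cons; under eq_integral do rewrite big_cons.
case: ifPn => // Qi; have [Hi1 Hi2] := H _ Qi.
rewrite integralD//; last by apply: integrable_sum => // j /H[].
by rewrite IH EFinD Hi2.
Qed.

Lemma eq_has_mean (f g : T -> R) (m : R) : f =1 g -> has_mean f m -> has_mean g m.
Proof. by move=> /funext ->. Qed.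

Lemma has_mean0 : has_mean (fun=> 0) 0.
Proof.
by split; [exact: integrable0|rewrite integral0].
Qed.

Lemma has_meanZ (c m : R) (f : T -> R) :
  has_mean f m -> has_mean (fun t => f t * c) (m * c).
Proof.
move=> [if_ Ef].
have E : EFin \o (fun t => f t * c) = (fun t => (c%:E * (EFin \o f) t)%E).
  by apply/funext => t /=; rewrite mulrC EFinM.
split; first by rewrite E; exact: integrableZl.
rewrite -[X in integral _ _ X]/(EFin \o (fun t => f t * c)) E integralZl//.
by rewrite Ef mulrC EFinM.
Qed.

Lemma has_meanD (m m' : R) (f f' : T -> R) :
  has_mean f m -> has_mean f' m' -> has_mean (fun t => f t + f' t) (m + m').
Proof.
move=> [i1 E1] [i2 E2]; split.
  rewrite (_ : EFin \o _ = ((EFin \o f) \+ (EFin \o f'))%E); last exact/funext.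
  exact: integrableD.
under eq_integral do rewrite EFinD.
by rewrite integralD// E1 E2.
Qed.

Lemma has_mean_indic (A : set T) (p : R) : measurable A -> P A = p%:E ->
  has_mean (\1_A) p.
Proof.
move=> mA PA; split; first exact: integrable_indic.
by rewrite integral_indic// setIT.
Qed.

(** Dominated convergence applied to the positive part of [Z N - b]: it is bounded
    by a constant and by [`|Y N - b|], so its mean tends to [0], and the means of
    [Z N] exceed [b] by no more than that. *)
Lemma mean_limit (Y Z : nat -> T -> R) (b M S : R) (e m : nat -> R) :
  {ae P, forall t, (fun N => Y N t) @ \oo --> b} ->
  (forall N t, 0 <= Z N t <= M) -> (forall N t, Z N t <= Y N t) ->
  (forall N, has_mean (Z N) (m N)) -> (forall N, e N <= m N) ->
  e @ \oo --> S -> S <= b.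
Proof.
move=> Yb Z0M ZY mZ em eS.
pose f N t := (Num.max (Z N t - b) 0)%:E : \bar R.
have mZN N : measurable_fun setT (Z N).
  by have [/measurable_int /measurable_EFinP] := mZ N.
have mf N : measurable_fun setT (f N).
  apply/measurable_EFinP; apply: measurable_maxr => //.
  exact: measurable_funB.
have f0 N t : (0 <= f N t)%E by rewrite lee_fin le_max lexx orbT.
have M0 : 0 <= M by have /andP[] := Z0M 0 point; exact: le_trans.
have fM N t : Num.max (Z N t - b) 0 <= M + `|b|.
  have /andP[_ ZM] := Z0M N t; have := ler_norm (- b); rewrite normrN => nb.
  by rewrite ge_max addr_ge0// andbT; lra.
have [_ _ lim] : [/\ P.-integrable setT (cst 0%E),
   [sequence (\int[P]_(x in setT) `|f n x - 0%E|)%E]_n x @[x --> \oo] --> 0%E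
   & [sequence (\int[P]_(x in setT) f n x)%E]_n x @[x --> \oo] -->
     (\int[P]_(x in setT) (cst 0%E) x)%E].
  apply: (@dominated_convergence _ _ _ _ _ _ _ _ (cst (M + `|b|)%:E)) => //.
  - apply: filterS Yb => t Yt _; apply/fine_cvgP; split; first by near=> N.
    apply: (@squeeze_cvgr _ _ _ _ (cst 0) (fun N => `|Y N t - b|)).
    + near=> N; rewrite /= le_max lexx orbT /= ge_max normr_ge0 andbT.
      by apply: le_trans (ler_norm _); rewrite lerD2r.
    + exact: cvg_cst.
    + by rewrite -(normr0 R) -(subrr b); apply: cvg_norm; apply: cvgB => //; exact: cvg_cst.
  - exact: finite_measure_integrable_cst.
  - by apply: aeW => t N _; rewrite gee0_abs// lee_fin.
rewrite integral0 in lim; move: lim => /fine_cvgP[fin lim].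
rewrite -subr_le0; apply: ler_cvg_to lim _; first by apply: cvgB eS _; exact: cvg_cst.
near=> N.
have finN : (\int[P]_(x in setT) f N x)%E \is a fin_num by near: N.
rewrite -lee_fin fineK//.
have [iZ EZ] := mZ N.
have iZb : P.-integrable setT (EFin \o (fun t => Z N t - b)).
  rewrite (_ : EFin \o _ = ((EFin \o Z N) \- cst b%:E)%E); last exact/funext.
  by apply: integrableB => //; exact: finite_measure_integrable_cst.
apply: (@le_trans _ _ (\int[P]_t (Z N t - b)%:E)%E).
  under eq_integral do rewrite EFinB.
  rewrite integralB//; last exact: finite_measure_integrable_cst.
  rewrite EZ integral_cst// [X in (_ * X)%E](_ : _ = 1%E); last exact: probability_setT.
  by rewrite mule1 -EFinB lee_fin lerD2r.
have if_ : P.-integrable setT (f N).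
  apply: (@le_integrable _ _ _ P setT measurableT _ (EFin \o cst (M + `|b|))) => //.
    by move=> t _; rewrite gee0_abs// lee_fin ger0_norm ?addr_ge0 ?fM.
  exact: finite_measure_integrable_cst.
by apply: le_integral => // t _; rewrite lee_fin le_max lexx.
Unshelve. all: by end_near. Qed.

End mean.

(** * Detecting isolation and twins on a grid *)

Section exclusive_sums.
Context (R : realDomainType) (I : finType).

Lemma sum_gt0_ex (Q : pred I) (f : I -> R) : 0 < \sum_(i | Q i) f i ->
  exists2 i, Q i & 0 < f i.
Proof.
move=> s0; have : [exists i, Q i && (0 < f i)].
  rewrite -[X in is_true X]negbK; apply/negP => /existsPn H.
  move: s0; rewrite ltNge sumr_le0// => i Qi.
  by have := H i; rewrite Qi /= -leNgt.
by move=> /existsP[i /andP[]]; exists i.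
Qed.

(** Indicators of mutually exclusive events sum to an indicator. The terms are
    allowed to be sums themselves, so that the lemma can be nested. *)
Lemma sum_exclusive_le (Q : pred I) (f : I -> R) (b : bool) :
  (forall i, Q i -> f i <= b%:R) ->
  (forall i j, Q i -> Q j -> 0 < f i -> 0 < f j -> i = j) ->
  \sum_(i | Q i) f i <= b%:R.
Proof.
move=> fb excl; rewrite leNgt; apply/negP => H.
have [i Qi fi] : exists2 i, Q i & 0 < f i.
  by apply: sum_gt0_ex; apply: le_lt_trans H; rewrite ler0n.
move: H; rewrite ltNge (bigD1 i)//= -[leRHS]addr0 lerD ?fb//.
apply: sumr_le0 => j /andP[Qj ji]; rewrite leNgt; apply/negP => fj.
by move: ji; rewrite (excl _ _ Qj Qi fj fi) eqxx.
Qed.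

End exclusive_sums.

Lemma indic_gt0 (R : realType) (T : Type) (A : set T) (t : T) :
  (0 < \1_A t :> R) -> A t.
Proof. by rewrite indicE ltr0n lt0b inE. Qed.

Lemma indic_le (R : realType) (T : Type) (A : set T) (t : T) (b : bool) :
  (A t -> b) -> \1_A t <= b%:R :> R.
Proof.
rewrite indicE ler_nat; case: (boolP (t \in A)) => //=.
by rewrite inE => At /(_ At) ->.
Qed.

Section patterns.
Context (R : realType).

Definition annulus (z : R * R) (a b : R) : set (R * R) := disc z b `\` disc z a.

Definition cell (z : R * R) (e : R) : set (R * R) :=
  `[z.1, z.1 + e[%classic `*` `[z.2, z.2 + e[%classic.

Lemma cell_dist (z p : R * R) (e : R) : cell z e p -> euclidean_dist z p <= 2 * e.
Proof.
move=> [] /=; rewrite !in_itv /= => /andP[a1 a2] /andP[b1 b2].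
rewrite euclidean_dist_leE; last by lra.
have : 0 <= p.1 - z.1 <= e by lra.
have : 0 <= p.2 - z.2 <= e by lra.
by move=> *; nra.
Qed.

Context (n : nat) (e : R).
Hypothesis e0 : 0 < e.

(** An event that constrains every point separately; for independent points its
    probability is a product. *)
Definition fits (A : 'I_n -> set (R * R)) (x : 'I_n -> R * R) : Prop :=
  forall i, A i (x i).

(** The disc contains [j] and no other point than [v]; the choice [j = v] stands
    for a disc without other points. *)
Definition sparse_pattern (z : R * R) (rho : R) (v j i : 'I_n) : set (R * R) :=
  if i == v then cell z e
  else if i == j then disc z rho else ~` disc z rho.

Definition twin_pattern (z : R * R) (rho : R) (A B : set (R * R)) (v j l i : 'I_n) :
    set (R * R) :=
  if i == v then cell z e
  else if i == j then A else if i == l then B else ~` disc z rho.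

Context (x : 'I_n -> R * R).
Let D u v := euclidean_dist (x u) (x v).

(** In this lemma and the next two, the disc around the corner [z] is larger by
    [2 * e] than the disc around the point of [v], which lies within [2 * e] of [z]. *)
Lemma sparse_pattern_isolated (z : R * R) (v : 'I_n) (r : R) :
  fits (sparse_pattern z (r + 2 * e) v v) x -> isolated D v r.
Proof.
move=> fx; apply/forallP => w; apply/implyP => wv.
have := fx v; rewrite /sparse_pattern eqxx => /cell_dist dv.
have := fx w; rewrite /sparse_pattern (negbTE wv) => /negP; rewrite -ltNge => dw.
by have := euclidean_dist_triangle z (x v) (x w); rewrite /D; lra.
Qed.

Lemma sparse_pattern_isolated_but_one (z : R * R) (v j : 'I_n) (r : R) :
  fits (sparse_pattern z (r + 2 * e) v j) x -> isolated_but_one D v r.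
Proof.
move=> fx; apply/existsP; exists j; apply/forallP => w.
apply/implyP => /andP[wv wj].
have := fx v; rewrite /sparse_pattern eqxx => /cell_dist dv.
have := fx w; rewrite /sparse_pattern (negbTE wv) (negbTE wj) => /negP.
rewrite -ltNge => dw.
by have := euclidean_dist_triangle z (x v) (x w); rewrite /D; lra.
Qed.

(** The second annulus is narrowed by [6 * e] at both ends because moving the
    centre from [z] to the point of [v] changes [2 * D v j] by [4 * e] and [D v l]
    by [2 * e]. *)
Lemma twin_pattern_twinned (z : R * R) (v j l : 'I_n) (a a' r r' : R) :
  j != v -> l != v -> l != j ->
  fits (twin_pattern z (r' + 2 * e) (annulus z a' a)
          (annulus z (2 * a + 6 * e) (r - 2 * a - 6 * e)) v j l) x ->
  twinned D v r r'.
Proof.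
move=> jv lv lj fx; apply/existsP; exists j; apply/existsP; exists l.
have := fx v; rewrite /twin_pattern eqxx => /cell_dist dv.
have := fx j; rewrite /twin_pattern (negbTE jv) eqxx => -[dj _].
have := fx l; rewrite /twin_pattern (negbTE lv) (negbTE lj) eqxx => -[dl /negP].
rewrite -ltNge => dl'; rewrite /disc /= in dj dl.
have t1 := euclidean_dist_triangle (x v) z (x j).
have t2 := euclidean_dist_triangle (x v) z (x l).
have t3 := euclidean_dist_triangle z (x v) (x l).
rewrite !(euclidean_distC (x v) z) in t1 t2.
apply/and5P; split => //.
- by rewrite eq_sym.
- by rewrite /D; apply/andP; split; lra.
apply/forallP => w; apply/implyP => /and3P[wv wj wl].
have := fx w; rewrite /twin_pattern (negbTE wv) (negbTE wj) (negbTE wl) => /negP.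
rewrite -ltNge => dw.
by have := euclidean_dist_triangle z (x v) (x w); rewrite /D; lra.
Qed.

Section grid.
Variables (M s : nat).

(** The grid leaves out a margin of [s] cells, so that discs of radius [s * e]
    around the corners stay inside the unit square. *)
Definition corner (c : 'I_M * 'I_M) : R * R := ((c.1 + s)%:R * e, (c.2 + s)%:R * e).

Lemma cell_corner_inj (c c' : 'I_M * 'I_M) (p : R * R) :
  cell (corner c) e p -> cell (corner c') e p -> c = c'.
Proof.
have key (a b : nat) (y : R) : a%:R * e <= y < a%:R * e + e ->
    b%:R * e <= y < b%:R * e + e -> (a <= b)%N.
  move=> /andP[ay _] /andP[_ yb]; rewrite leqNgt; apply/negP => ba.
  have : b.+1%:R * e <= a%:R * e by rewrite ler_pM2r// ler_nat.
  by rewrite -natr1; lra.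
have key2 (a b : nat) (y : R) : a%:R * e <= y < a%:R * e + e ->
    b%:R * e <= y < b%:R * e + e -> a = b.
  by move=> ha hb; apply/eqP; rewrite eqn_leq (key _ _ _ ha hb) (key _ _ _ hb ha).
move=> [] /=; rewrite !in_itv /= => a1 a2 [] /=; rewrite !in_itv /= => b1 b2.
case: c c' a1 a2 b1 b2 => [c1 c2] [c1' c2'] /= a1 a2 b1 b2.
by congr pair; apply/val_inj; apply: (@addIn s);
  [exact: key2 a1 b1|exact: key2 a2 b2].
Qed.

Lemma sum_isolated_le (v : 'I_n) (r : R) :
  \sum_(c : 'I_M * 'I_M) \1_(fits (sparse_pattern (corner c) (r + 2 * e) v v)) x
    <= (isolated D v r)%:R :> R.
Proof.
apply: sum_exclusive_le => [c _|c c' _ _].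
  by apply: indic_le; exact: sparse_pattern_isolated.
move=> g g'.
have f := indic_gt0 g.
have f' := indic_gt0 g'.
move: (f v) (f' v).
by rewrite /sparse_pattern eqxx; exact: cell_corner_inj.
Qed.

Lemma sum_isolated_but_one_le (v : 'I_n) (r : R) :
  \sum_(c : 'I_M * 'I_M) \sum_j
     \1_(fits (sparse_pattern (corner c) (r + 2 * e) v j)) x
    <= (isolated_but_one D v r)%:R :> R.
Proof.
apply: sum_exclusive_le => [c _|c c' _ _].
  apply: sum_exclusive_le => [j _|j j' _ _].
    by apply: indic_le; exact: sparse_pattern_isolated_but_one.
  move=> gj gj'.
  have fj := indic_gt0 gj.
  have fj' := indic_gt0 gj'.
  apply/eqP/negPn/negP => jj'.
  have [jv|jv] := eqVneq j v.
    have := fj j'; have := fj' j'; rewrite /sparse_pattern -jv eq_sym (negbTE jj') eqxx.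
    by move=> h1 h2; exact: (h2 h1).
  have := fj j; have := fj' j.
  by rewrite /sparse_pattern (negbTE jv) (negbTE jj') eqxx => h1 h2; exact: (h1 h2).
move=> /sum_gt0_ex[j _ g] /sum_gt0_ex[j' _ g'].
have f := indic_gt0 g.
have f' := indic_gt0 g'.
move: (f v) (f' v).
by rewrite /sparse_pattern eqxx; exact: cell_corner_inj.
Qed.

(** The patterns exclude each other: the cell of [v] determines [c]; the points in
    the disc are [j] and [l], and [j] is the closer one to the corner; the distance
    of [j] determines the step [i]. *)
Lemma sum_twinned_le (v : 'I_n) (r r' : R) (m : nat) (a : nat -> R) :
  {homo a : i i' / (i <= i')%N >-> i <= i'} -> (forall i, (i <= m)%N -> 0 <= a i <= r') ->
  r <= r' ->
  \sum_(c : 'I_M * 'I_M) \sum_(j | j != v) \sum_(l | (l != v) && (l != j))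
    \sum_(i < m) \1_(fits (twin_pattern (corner c) (r' + 2 * e)
       (annulus (corner c) (a i) (a i.+1))
       (annulus (corner c) (2 * a i.+1 + 6 * e) (r - 2 * a i.+1 - 6 * e)) v j l)) x
    <= (twinned D v r r')%:R :> R.
Proof.
move=> am ar rr'.
have dist_j c j l (i : 'I_m) : j != v -> fits (twin_pattern (corner c) (r' + 2 * e)
       (annulus (corner c) (a i) (a i.+1))
       (annulus (corner c) (2 * a i.+1 + 6 * e) (r - 2 * a i.+1 - 6 * e)) v j l) x ->
    a i < euclidean_dist (corner c) (x j) <= a i.+1.
  move=> jv /(_ j); rewrite /twin_pattern (negbTE jv) eqxx => -[-> /negP].
  by rewrite -ltNge => ->.
have dist_l c j l (i : 'I_m) : l != v -> l != j -> fits (twin_pattern (corner c) (r' + 2 * e)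
       (annulus (corner c) (a i) (a i.+1))
       (annulus (corner c) (2 * a i.+1 + 6 * e) (r - 2 * a i.+1 - 6 * e)) v j l) x ->
    a i.+1 < euclidean_dist (corner c) (x l) <= r'.
  move=> lv lj /(_ l); rewrite /twin_pattern (negbTE lv) (negbTE lj) eqxx => -[].
  rewrite /disc /= => d1 /negP; rewrite -ltNge => d2.
  have /andP[a0 _] := ar i.+1 (ltn_ord i).
  by have e1 := e0; apply/andP; split; lra.
have dist_o c j l (i : 'I_m) w : w != v -> fits (twin_pattern (corner c) (r' + 2 * e)
       (annulus (corner c) (a i) (a i.+1))
       (annulus (corner c) (2 * a i.+1 + 6 * e) (r - 2 * a i.+1 - 6 * e)) v j l) x ->
    euclidean_dist (corner c) (x w) <= r' -> (w == j) || (w == l).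
  move=> wv /(_ w); rewrite /twin_pattern (negbTE wv).
  case: eqP => //= _; case: eqP => //= _ /negP.
  by rewrite -ltNge => d1 d2; exfalso; have := e0; lra.
apply: sum_exclusive_le => [c _|c c' _ _]; last first.
  move=> /sum_gt0_ex[j _ /sum_gt0_ex[l _ /sum_gt0_ex[i _ g]]].
  have f := indic_gt0 g.
  move=> /sum_gt0_ex[j' _ /sum_gt0_ex[l' _ /sum_gt0_ex[i' _ g']]].
  have f' := indic_gt0 g'.
  move: (f v) (f' v).
  by rewrite /twin_pattern eqxx; exact: cell_corner_inj.
apply: sum_exclusive_le => [j jv|j j' jv j'v]; last first.
  move=> /sum_gt0_ex[l /andP[lv lj] /sum_gt0_ex[i _ g]].
  have f := indic_gt0 g.
  move=> /sum_gt0_ex[l' /andP[l'v l'j] /sum_gt0_ex[i' _ g']].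
  have f' := indic_gt0 g'.
  have /andP[_ dj] := dist_j _ _ _ _ jv f; have /andP[dl dl'] := dist_l _ _ _ _ lv lj f.
  have /andP[_ ej] := dist_j _ _ _ _ j'v f'; have /andP[el el'] := dist_l _ _ _ _ l'v l'j f'.
  have : (j' == j) || (j' == l) by apply: dist_o f _ => //; lra.
  have : (j == j') || (j == l') by apply: dist_o f' _ => //; lra.
  case: eqP => //= _ /eqP jl' /orP[/eqP//|/eqP j'l].
  by exfalso; rewrite -jl' in el; rewrite j'l in ej; clear jl' j'l; lra.
apply: sum_exclusive_le => [l /andP[lv lj]|l l' /andP[lv lj] /andP[l'v l'j]]; last first.
  move=> /sum_gt0_ex[i _ g] /sum_gt0_ex[i' _ g'].
  have f := indic_gt0 g.
  have f' := indic_gt0 g'.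
  have /andP[_ dl] := dist_l _ _ _ _ lv lj f.
  have : (l == j) || (l == l') by apply: dist_o f' _.
  by rewrite (negbTE lj) => /eqP.
apply: sum_exclusive_le => [i _|i i' _ _]; last first.
  move=> g g'.
  have f := indic_gt0 g.
  have f' := indic_gt0 g'.
  have /andP[d1 d2] := dist_j _ _ _ _ jv f.
  have /andP[d1' d2'] := dist_j _ _ _ _ jv f'.
  apply: ord_inj; apply/eqP; rewrite eqn_leq.
  apply/andP; split; rewrite leqNgt; apply/negP => ii'.
    by have := am _ _ ii'; lra.
  by have := am _ _ ii'; lra.
by apply: indic_le; exact: twin_pattern_twinned.
Qed.

End grid.

End patterns.

(** * Probabilities of discs, annuli and cells *)

Section pattern_probability.
Context (d : measure_display) (T : measurableType d) (R : realType)
  (P : probability T R) (X : nat -> {RV P >-> (R * R)%type}).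
Hypothesis X_unif : forall i, uniform_on_unit_square (X i).
Hypothesis X_indep : mutually_independent X.

Lemma fits_bigcap (n : nat) (A : nat -> set (R * R)) :
  [set t | fits (fun i : 'I_n => A i) (fun i => X i t)] =
  \bigcap_(i in [set` [fset k | k in iota 0 n]%fset]) X i @^-1` A i.
Proof.
apply/seteqP; split => t /= H.
  move=> i /=; rewrite in_fset /= mem_iota /= => ni.
  exact: (H (Ordinal ni)).
by move=> i; apply: (H i); rewrite /= in_fset /= mem_iota /=.
Qed.

(** Independence is stated for families of sets indexed by all natural numbers, to
    which a family over ['I_n] is extended by the whole plane. *)
Lemma fits_nat (n : nat) (A : 'I_n -> set (R * R)) :
  exists2 A' : nat -> set (R * R), (forall i : 'I_n, A' i = A i)
     & ((forall i, measurable (A i)) -> forall k, measurable (A' k)).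
Proof.
exists (fun k => if insub k is Some i then A i else setT) => [i|mA k].
  by rewrite valK.
by case: insubP.
Qed.

Lemma measurable_fits (n : nat) (A : 'I_n -> set (R * R)) :
  (forall i, measurable (A i)) ->
  measurable [set t | fits A (fun i => X i t)].
Proof.
move=> mA; have [A' EA mA'] := fits_nat A.
have -> : [set t | fits A (fun i => X i t)] =
    [set t | fits (fun i : 'I_n => A' i) (fun i => X i t)].
  by apply/seteqP; split => t /= H i; have := H i; rewrite EA.
rewrite fits_bigcap; apply: fin_bigcap_measurable; first exact: finite_fset.
move=> i _; rewrite -[_ @^-1` _]setTI; apply: measurable_funP => //.
exact: mA'.
Qed.

Lemma prob_fits (n : nat) (A : 'I_n -> set (R * R)) (f : 'I_n -> R) :
  (forall i, measurable (A i)) ->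
  (forall i : 'I_n, P (X i @^-1` A i) = (f i)%:E) ->
  P [set t | fits A (fun i => X i t)] = (\prod_i f i)%:E.
Proof.
move=> mA Pf; have [A' EA mA'] := fits_nat A.
have -> : [set t | fits A (fun i => X i t)] =
    [set t | fits (fun i : 'I_n => A' i) (fun i => X i t)].
  by apply/seteqP; split => t /= H i; have := H i; rewrite EA.
rewrite fits_bigcap X_indep; last exact: mA'.
rewrite (perm_big (iota 0 n)); last first.
  apply: uniq_perm; [exact: fset_uniq|exact: iota_uniq|].
  by move=> i; rewrite in_fset.
have -> : iota 0 n = index_iota 0 n by rewrite /index_iota subn0.
rewrite big_mkord -prodEFin; apply: eq_bigr => i _.
by rewrite EA Pf.
Qed.

Lemma prob_unif (i : nat) (A : set (R * R)) : measurable A ->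
  A `<=` unit_square R -> P (X i @^-1` A) = area A.
Proof.
by move=> mA sub; have := X_unif i mA; rewrite (setIidl sub).
Qed.

Lemma measurable_cell (z : R * R) (e : R) : measurable (cell z e).
Proof. by apply: measurableX; exact: measurable_itv. Qed.

Lemma measurable_annulus (z : R * R) (a b : R) : measurable (annulus z a b).
Proof. by apply: measurableD; exact: measurable_disc. Qed.

Lemma prob_cell (i : nat) (z : R * R) (e : R) : 0 <= e ->
  cell z e `<=` unit_square R -> P (X i @^-1` cell z e) = (e ^+ 2)%:E.
Proof.
move=> e0 sub; rewrite prob_unif//; last exact: measurable_cell.
have itv (a : R) : lebesgue_measure (`[a, a + e[%classic : set R) = e%:E.
  rewrite lebesgue_measure_itv /= lte_fin ltrDl; case: ltP => [_|e0'].
    by rewrite -EFinB; congr EFin; ring.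
  by congr EFin; apply: le_anti; rewrite e0 e0'.
rewrite /area /cell product_measure1E; [|exact: measurable_itv..].
by rewrite expr2 EFinM; congr (_ * _)%E; exact: itv.
Qed.

Lemma prob_disc (i : nat) (z : R * R) (r : R) : 0 <= r ->
  disc z r `<=` unit_square R -> P (X i @^-1` disc z r) = (pi * r ^+ 2)%:E.
Proof.
by move=> r0 sub; rewrite prob_unif ?area_disc//; exact: measurable_disc.
Qed.

Lemma measurable_preimage_RV (i : nat) (A : set (R * R)) : measurable A ->
  measurable (X i @^-1` A).
Proof. by move=> mA; rewrite -[_ @^-1` _]setTI; exact: measurable_funP. Qed.

Lemma prob_not_disc (i : nat) (z : R * R) (r : R) : 0 <= r ->
  disc z r `<=` unit_square R ->
  P (X i @^-1` (~` disc z r)) = (1 - pi * r ^+ 2)%:E.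
Proof.
move=> r0 sub; rewrite preimage_setC probability_setC ?prob_disc//.
exact: (measurable_preimage_RV i (measurable_disc z r)).
Qed.

Lemma disc_sub (z : R * R) (a b : R) : a <= b -> disc z a `<=` disc z b.
Proof. by move=> ab p /= zp; exact: le_trans zp ab. Qed.

Lemma prob_annulus (i : nat) (z : R * R) (a b : R) : 0 <= a -> a <= b ->
  disc z b `<=` unit_square R ->
  P (X i @^-1` annulus z a b) = (pi * (b ^+ 2 - a ^+ 2))%:E.
Proof.
move=> a0 ab sub; have b0 := le_trans a0 ab.
have sub' := subset_trans (disc_sub ab) sub.
have -> : X i @^-1` annulus z a b = X i @^-1` disc z b `\` X i @^-1` disc z a by [].
have mX r := measurable_preimage_RV i (measurable_disc z r).
have Pb := prob_disc i b0 sub; have Pa := prob_disc i a0 sub'.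
have fin : (P (X i @^-1` disc z b) < +oo)%E by rewrite Pb ltry.
transitivity (P (X i @^-1` disc z b) - P (X i @^-1` disc z b `&` X i @^-1` disc z a))%E.
  by apply: measureD => //; exact: mX.
rewrite (setIidr (@preimage_subset _ _ _ _ _ (disc_sub ab))).
by rewrite Pa Pb -EFinB mulrBr.
Qed.

End pattern_probability.

(** * Probabilities of patterns *)

Lemma card_ord_neq (n : nat) (v : 'I_n) : #|[pred j | j != v]| = n.-1.
Proof.
by have := cardC1 v; rewrite card_ord => <-; apply: eq_card => i; rewrite !inE.
Qed.

Lemma card_ord_neq2 (n : nat) (v j : 'I_n) :
  j != v -> #|[pred l | (l != v) && (l != j)]| = n.-2.
Proof.
move=> jv; have := cardsC [set v; j]%SET; rewrite cards2 eq_sym jv card_ord => E.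
transitivity #|~: [set v; j]%SET|; last by move: E; rewrite -subn2; lia.
by apply: eq_card => i; rewrite !inE negb_or.
Qed.

Lemma prod_at (R : comPzRingType) (I : finType) (Q : pred I) (v : I) (a : R) (F : I -> R) :
  Q v -> \prod_(i | Q i) (if i == v then a else F i) =
         a * \prod_(i | Q i && (i != v)) F i.
Proof.
move=> Qv; rewrite (bigD1 v)//= eqxx; congr (_ * _).
by apply: eq_bigr => i /andP[_ /negbTE ->].
Qed.

Lemma prod_one_special (R : comPzRingType) (n : nat) (v : 'I_n) (a o : R) :
  \prod_(i < n) (if i == v then a else o) = a * o ^+ n.-1.
Proof.
rewrite prod_at// prodr_const; congr (_ * _ ^+ _).
exact: card_ord_neq.
Qed.

Lemma prod_two_special (R : comPzRingType) (n : nat) (v j : 'I_n) (a b o : R) : j != v ->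
  \prod_(i < n) (if i == v then a else if i == j then b else o) =
    a * b * o ^+ n.-2.
Proof.
move=> jv; rewrite prod_at// prod_at// prodr_const mulrA; congr (_ * _ ^+ _).
exact: card_ord_neq2.
Qed.

Lemma prod_three_special (R : comPzRingType) (n : nat) (v j l : 'I_n) (a b c o : R) :
  j != v -> l != v -> l != j ->
  \prod_(i < n) (if i == v then a else if i == j then b else if i == l then c else o)
    = a * b * c * o ^+ (n - 3).
Proof.
move=> jv lv lj; rewrite prod_at// prod_at// prod_at ?lv ?lj// prodr_const !mulrA.
congr (_ * _ ^+ _).
have := cardsC (l |: [set v; j])%SET.
rewrite cardsU1 cards2 !inE (negbTE lv) (negbTE lj) eq_sym jv card_ord /= => E.
transitivity #|~: (l |: [set v; j])%SET|; last first.
  by move: E; move: #|_| => k <-; rewrite addKn.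
by apply: eq_card => i; rewrite !inE !negb_or andbC.
Qed.

Section pattern_means.
Context (d : measure_display) (T : measurableType d) (R : realType)
  (P : probability T R) (X : nat -> {RV P >-> (R * R)%type}).
Hypothesis X_unif : forall i, uniform_on_unit_square (X i).
Hypothesis X_indep : mutually_independent X.
Context (n M s : nat) (e : R).
Hypothesis e0 : 0 < e.
Hypothesis Me : (M + 2 * s)%:R * e <= 1.

Let pts (t : T) (i : 'I_n) : R * R := X i t.

Lemma corner_disc_sub (c : 'I_M * 'I_M) (r : R) : 0 <= r -> r <= s%:R * e ->
  disc (corner e s c) r `<=` unit_square R.
Proof.
move=> r0 rs p; rewrite /disc /= euclidean_dist_leE// => H.
have key (a : 'I_M) (y : R) : ((a + s)%:R * e - y) ^+ 2 <= r ^+ 2 -> 0 <= y <= 1.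
  rewrite -ler_sqrt ?sqr_ge0// !sqrtr_sqr (ger0_norm r0) ler_distl => /andP[y1 y2].
  have a1 : (s%:R : R) * e <= (a + s)%:R * e by rewrite (ler_wpM2r (ltW e0))// ler_nat leq_addl.
  have a2 : (a + s)%:R * e + s%:R * e <= (M + 2 * s)%:R * e.
    by rewrite -mulrDl -natrD (ler_wpM2r (ltW e0))// ler_nat; have := ltn_ord a; lia.
  have := Me; lra.
split; rewrite /= in_itv /=.
  by apply: key c.1 _ _; apply: le_trans H; rewrite lerDl sqr_ge0.
by apply: key c.2 _ _; apply: le_trans H; rewrite lerDr sqr_ge0.
Qed.

Lemma corner_cell_sub (c : 'I_M * 'I_M) : cell (corner e s c) e `<=` unit_square R.
Proof.
have key (a : 'I_M) (y : R) : (a + s)%:R * e <= y < (a + s)%:R * e + e -> 0 <= y <= 1.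
  move=> /andP[y1 y2].
  have a1 : 0 <= (a + s)%:R * e by exact: mulr_ge0 (ler0n _ _) (ltW e0).
  have a2 : (a + s)%:R * e + e <= (M + 2 * s)%:R * e.
    have -> : (a + s)%:R * e + e = (a + s + 1)%:R * e by rewrite (natrD _ _ 1) mulrDl mul1r.
    rewrite (ler_wpM2r (ltW e0))// ler_nat.
    by have := ltn_ord a; lia.
  have := Me; lra.
by move=> p [] /=; rewrite !in_itv /= => H1 H2; split;
  rewrite /= in_itv /=; [exact: key H1|exact: key H2].
Qed.

Lemma has_mean_fits (A : 'I_n -> set (R * R)) (f : 'I_n -> R) :
  (forall i, measurable (A i)) ->
  (forall i : 'I_n, P (X i @^-1` A i) = (f i)%:E) ->
  has_mean P (fun t => \1_(fits A) (pts t)) (\prod_i f i).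
Proof.
move=> mA PA.
have -> : (fun t => \1_(fits A) (pts t)) = \1_[set t | fits A (fun i => X i t)] :> (T -> R).
  by apply/funext => t; rewrite !indicE; congr (_ %:R); apply/idP/idP; rewrite !inE.
by apply: has_mean_indic; [exact: measurable_fits|exact: prob_fits].
Qed.

Lemma has_mean_sparse (c : 'I_M * 'I_M) (rho : R) (v j : 'I_n) :
  0 <= rho -> rho <= s%:R * e ->
  let p := pi * rho ^+ 2 in
  has_mean P (fun t => \1_(fits (sparse_pattern e (corner e s c) rho v j)) (pts t))
    (if j == v then e ^+ 2 * (1 - p) ^+ n.-1 else e ^+ 2 * p * (1 - p) ^+ n.-2).
Proof.
move=> r0 rs p.
have sub := @corner_disc_sub c _ r0 rs; have csub := @corner_cell_sub c.
pose f (i : 'I_n) := if i == v then e ^+ 2 else if i == j then p else 1 - p.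
have -> : (if j == v then e ^+ 2 * (1 - p) ^+ n.-1 else e ^+ 2 * p * (1 - p) ^+ n.-2)
    = \prod_i f i.
  rewrite /f; case: eqVneq => [->|jv]; last by rewrite prod_two_special.
  by rewrite -(prod_one_special v); apply: eq_bigr => i _; case: eqP.
apply: has_mean_fits => i; rewrite /sparse_pattern /f.
  case: ifP => _; first exact: measurable_cell.
  by case: ifP => _; [|apply: measurableC]; exact: measurable_disc.
case: ifP => _; first by rewrite prob_cell// ltW.
by case: ifP => _; [rewrite prob_disc|rewrite prob_not_disc].
Qed.

Lemma has_mean_twin (c : 'I_M * 'I_M) (rho a a' b b' : R) (v j l : 'I_n) :
  j != v -> l != v -> l != j ->
  0 <= rho -> rho <= s%:R * e -> 0 <= a -> a <= a' -> a' <= rho ->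
  0 <= b -> b <= b' -> b' <= rho ->
  has_mean P (fun t => \1_(fits (twin_pattern e (corner e s c) rho
      (annulus (corner e s c) a a') (annulus (corner e s c) b b') v j l)) (pts t))
    (e ^+ 2 * (pi * (a' ^+ 2 - a ^+ 2)) * (pi * (b' ^+ 2 - b ^+ 2))
      * (1 - pi * rho ^+ 2) ^+ (n - 3)).
Proof.
move=> jv lv lj r0 rs a0 aa' ar b0 bb' br.
have sub := @corner_disc_sub c _ r0 rs; have csub := @corner_cell_sub c.
have suba := subset_trans (disc_sub ar) sub.
have subb := subset_trans (disc_sub br) sub.
rewrite -(prod_three_special _ _ _ _ jv lv lj).
apply: has_mean_fits => i; rewrite /twin_pattern.
  case: ifP => _; first exact: measurable_cell.
  case: ifP => _; first exact: measurable_annulus.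
  case: ifP => _; first exact: measurable_annulus.
  by apply: measurableC; exact: measurable_disc.
case: ifP => _; first by rewrite prob_cell// ltW.
case: ifP => _; first by rewrite prob_annulus.
case: ifP => _; first by rewrite prob_annulus.
by rewrite prob_not_disc.
Qed.

End pattern_means.

(** * The mean count at one level *)

(** The terms are the areas of the products of annuli of [step_radius], up to a
    common factor. *)
Lemma sum_staircase (R : realFieldType) (A : R) (j : nat) :
  \sum_(i < j) (2 * i%:R + 1) * (A - i.+1%:R) =
  A * j%:R ^+ 2 - j%:R * (j%:R + 1) * (4 * j%:R - 1) / 6.
Proof.
elim: j => [|j IH]; first by rewrite big_ord0; ring.
by rewrite big_ord_recr /= IH -natr1; field.
Qed.

Section level_count.
Context (R : realType) (n M s m : nat) (e : R).
Hypothesis e0 : 0 < e.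
Hypothesis m0 : (0 < m)%N.

(** The first annulus of step [i] ends at [a = step_radius k i.+1], the second runs
    from [2 * a + 6 * e] to [k * e - 2 * a - 6 * e]. The last step is the one at
    which the second annulus becomes empty, that is [4 * a = (k - 12) * e]. *)
Definition step_radius (k i : nat) : R := i%:R * ((k%:R - 12) * e / (4 * m%:R)).

(** The weights [2], [2] and [1] are those of [shortest_tour_lower_bound]. Twins
    are counted from level [12] on, where the annuli have nonnegative widths. *)
Definition level_count (v : 'I_n) (k : nat) (x : 'I_n -> R * R) : R :=
  2 * \sum_(c : 'I_M * 'I_M)
        \1_(fits (sparse_pattern e (corner e s c) (k.+1%:R * e + 2 * e) v v)) x
  + 2 * \sum_(c : 'I_M * 'I_M) \sum_j
        \1_(fits (sparse_pattern e (corner e s c) (k.+1%:R * e + 2 * e) v j)) x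
  + (12 <= k)%N%:R *
    \sum_(c : 'I_M * 'I_M) \sum_(j | j != v) \sum_(l | (l != v) && (l != j))
    \sum_(i < m) \1_(fits (twin_pattern e (corner e s c) (k.+1%:R * e + 2 * e)
       (annulus (corner e s c) (step_radius k i) (step_radius k i.+1))
       (annulus (corner e s c) (2 * step_radius k i.+1 + 6 * e)
          (k%:R * e - 2 * step_radius k i.+1 - 6 * e)) v j l)) x.

Lemma step_radius_homo (k : nat) : (12 <= k)%N ->
  {homo step_radius k : i j / (i <= j)%N >-> i <= j}.
Proof.
move=> k12 i j ij; apply: ler_wpM2r; last by rewrite ler_nat.
rewrite divr_ge0 ?mulr_ge0 ?(ltW e0)// subr_ge0.
by rewrite ler_nat.
Qed.

Lemma step_radius_bound (k i : nat) : (12 <= k)%N -> (i <= m)%N ->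
  0 <= step_radius k i /\ 4 * step_radius k i <= (k%:R - 12) * e.
Proof.
move=> k12 im; split.
  by rewrite -[leLHS](_ : step_radius k 0 = 0) ?step_radius_homo// /step_radius mul0r.
apply: le_trans (_ : 4 * step_radius k m <= _).
  by rewrite ler_wpM2l// step_radius_homo.
have m0' : (m%:R : R) != 0 by rewrite pnatr_eq0 -lt0n.
by rewrite le_eqVlt; apply/orP; left; apply/eqP; rewrite /step_radius; field.
Qed.

Lemma level_count_le (v : 'I_n) (k : nat) (x : 'I_n -> R * R)
    (D := fun u w => euclidean_dist (x u) (x w)) :
  level_count v k x <=
    2 * ((isolated D v (k.+1%:R * e))%:R + (isolated_but_one D v (k.+1%:R * e))%:R)
    + (twinned D v (k%:R * e) (k.+1%:R * e))%:R.
Proof.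
rewrite mulrDr; apply: lerD; first apply: lerD.
- by rewrite ler_wpM2l//; exact: sum_isolated_le.
- by rewrite ler_wpM2l//; exact: sum_isolated_but_one_le.
have [k12|k12] := boolP (12 <= k)%N; last by rewrite mul0r ler0n.
rewrite mul1r; apply: sum_twinned_le => //.
- exact: step_radius_homo.
- move=> i im; have [a1 a2] := step_radius_bound k12 im; rewrite a1 /=.
  have k12' : 12 <= k%:R :> R by rewrite ler_nat.
  by have := e0; rewrite -natr1; nra.
- by rewrite (ler_wpM2r (ltW e0))// ler_nat.
Qed.

Lemma level_count_ge0 (v : 'I_n) (k : nat) (x : 'I_n -> R * R) :
  0 <= level_count v k x.
Proof.
have ind (A : set ('I_n -> R * R)) : 0 <= \1_A x :> R by rewrite indicE.
rewrite !addr_ge0 ?mulr_ge0// !sumr_ge0// => c _; rewrite sumr_ge0// => j _.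
by rewrite sumr_ge0// => l _; rewrite sumr_ge0.
Qed.

Lemma level_count_le5 (v : 'I_n) (k : nat) (x : 'I_n -> R * R) : level_count v k x <= 5.
Proof.
apply: le_trans (level_count_le v k x) _.
have b (c : bool) : c%:R <= 1 :> R by rewrite lern1 leq_b1.
set D := fun _ _ => _.
have := b (isolated D v (k.+1%:R * e)).
have := b (isolated_but_one D v (k.+1%:R * e)).
have := b (twinned D v (k%:R * e) (k.+1%:R * e)).
lra.
Qed.

Lemma sum_level_count_le (K : nat) (x : 'I_n -> R * R) : (3 < n)%N ->
  \sum_(v < n) \sum_(k < K) level_count v k x * e <= 4 * shortest_tour_length x.
Proof.
move=> n3; apply: le_trans (shortest_tour_lower_bound K x n3 (ltW e0)).
apply: ler_sum => v _.
rewrite /two_neighbour_sum /twin_sum mulr_sumr -big_split /=.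
apply: ler_sum => k _; rewrite mulrA -mulrDl (ler_wpM2r (ltW e0))//.
exact: level_count_le.
Qed.

Section mean.
Context (d : measure_display) (T : measurableType d)
  (P : probability T R) (X : nat -> {RV P >-> (R * R)%type}).
Hypothesis X_unif : forall i, uniform_on_unit_square (X i).
Hypothesis X_indep : mutually_independent X.
Hypothesis Me : (M + 2 * s)%:R * e <= 1.

(** The sum over the steps of the product of the areas of the two annuli. *)
Definition twin_density (k : nat) : R := (12 <= k)%N%:R *
  (pi ^+ 2 * e ^+ 4 * k%:R * (k%:R - 12) ^+ 3
    * ((m%:R - 1) * (2 * m%:R - 1) / (96 * m%:R ^+ 2))).

(** With [a = step_radius k i.+1], the squares of the radii of the second annulus
    differ by [k * e * ((k - 12) * e - 4 * a)], which is linear in the step. *)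
Lemma sum_twin_areas (k : nat) :
  \sum_(i < m) (pi * (step_radius k i.+1 ^+ 2 - step_radius k i ^+ 2)) *
      (pi * ((k%:R * e - 2 * step_radius k i.+1 - 6 * e) ^+ 2
           - (2 * step_radius k i.+1 + 6 * e) ^+ 2))
  = pi ^+ 2 * e ^+ 4 * k%:R * (k%:R - 12) ^+ 3
    * ((m%:R - 1) * (2 * m%:R - 1) / (96 * m%:R ^+ 2)).
Proof.
have m0' : (m%:R : R) != 0 by rewrite pnatr_eq0 -lt0n.
transitivity (pi ^+ 2 * e ^+ 4 * k%:R * (k%:R - 12) ^+ 3 / (16 * m%:R ^+ 3)
   * \sum_(i < m) (2 * i%:R + 1) * (m%:R - i.+1%:R)).
  rewrite mulr_sumr; apply: eq_bigr => i _; rewrite /step_radius -natr1.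
  by field.
by rewrite sum_staircase; field.
Qed.

Lemma has_mean_level_count (v : 'I_n) (k : nat) : (k + 3 <= s)%N -> (2 < n)%N ->
  let p := pi * (k.+1%:R * e + 2 * e) ^+ 2 in
  has_mean P (fun t => level_count v k (fun i => X i t))
    ((M * M)%:R * e ^+ 2 * (4 * (1 - p) ^+ n.-1
      + 2 * n.-1%:R * p * (1 - p) ^+ n.-2
      + n.-1%:R * n.-2%:R * twin_density k * (1 - p) ^+ (n - 3))).
Proof.
move=> ks n2 p.
have rho0 : 0 <= k.+1%:R * e + 2 * e by rewrite addr_ge0 ?mulr_ge0 ?(ltW e0).
have rhos : k.+1%:R * e + 2 * e <= s%:R * e.
  rewrite -mulrDl (ler_wpM2r (ltW e0))//.
  by rewrite -natrD ler_nat; move: ks; lia.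
have E : (M * M)%:R * e ^+ 2 * (4 * (1 - p) ^+ n.-1
      + 2 * n.-1%:R * p * (1 - p) ^+ n.-2
      + n.-1%:R * n.-2%:R * twin_density k * (1 - p) ^+ (n - 3))
  = 2 * (\sum_(c : 'I_M * 'I_M) e ^+ 2 * (1 - p) ^+ n.-1)
  + 2 * (\sum_(c : 'I_M * 'I_M) \sum_(j < n) if j == v then e ^+ 2 * (1 - p) ^+ n.-1
       else e ^+ 2 * p * (1 - p) ^+ n.-2)
  + (12 <= k)%N%:R * \sum_(c : 'I_M * 'I_M) \sum_(j | j != v)
      \sum_(l | (l != v) && (l != j)) \sum_(i < m)
      e ^+ 2 * (pi * (step_radius k i.+1 ^+ 2 - step_radius k i ^+ 2)) *
      (pi * ((k%:R * e - 2 * step_radius k i.+1 - 6 * e) ^+ 2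
           - (2 * step_radius k i.+1 + 6 * e) ^+ 2)) * (1 - p) ^+ (n - 3).
  have sumc (y : R) : \sum_(c : 'I_M * 'I_M) y = (M * M)%:R * y.
    by rewrite sumr_const card_prod !card_ord [RHS]mulr_natl.
  rewrite !sumc.
  have -> : \sum_(j < n) (if j == v then e ^+ 2 * (1 - p) ^+ n.-1
       else e ^+ 2 * p * (1 - p) ^+ n.-2) =
      e ^+ 2 * (1 - p) ^+ n.-1 + n.-1%:R * (e ^+ 2 * p * (1 - p) ^+ n.-2).
    rewrite (bigD1 v)//= eqxx; congr (_ + _).
    rewrite (eq_bigr (fun=> e ^+ 2 * p * (1 - p) ^+ n.-2)).
      by rewrite sumr_const card_ord_neq mulr_natl.
    by move=> j /negbTE ->.
  set C := e ^+ 2 * (1 - p) ^+ (n - 3) *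
     (pi ^+ 2 * e ^+ 4 * k%:R * (k%:R - 12) ^+ 3
    * ((m%:R - 1) * (2 * m%:R - 1) / (96 * m%:R ^+ 2))).
  rewrite (_ : \sum_(j | j != v) _ = n.-1%:R * (n.-2%:R * C)); last first.
    rewrite (eq_bigr (fun=> n.-2%:R * C)); first by rewrite sumr_const card_ord_neq [RHS]mulr_natl.
    move=> j jv; rewrite (eq_bigr (fun=> C)); first by rewrite sumr_const card_ord_neq2 ?mulr_natl.
    move=> l _; rewrite /C -sum_twin_areas mulr_sumr; apply: eq_bigr => i _.
    by move: (_ ^+ (n - 3)) => pw; ring.
  rewrite /twin_density /C.
  move: (_ ^+ (n - 3)) (_ ^+ n.-1) (_ ^+ n.-2) (n.-1%:R) (n.-2%:R) ((M * M)%:R)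
    ((12 <= k)%N%:R) (_ / (96 * _)) => c1 c2 c3 c4 c5 c6 c7 c8.
  by ring.
rewrite E /level_count.
have cM c f mm : has_mean P f mm -> has_mean P (fun t => c * f t) (c * mm).
  move=> H; rewrite mulrC (_ : (fun t => _) = (fun t => f t * c)); last first.
    by apply/funext => t; rewrite mulrC.
  exact: has_meanZ.
apply: has_meanD; first apply: has_meanD.
- apply: cM; apply: has_mean_sum => c _.
  have := has_mean_sparse X_unif X_indep e0 Me c v v rho0 rhos.
  by rewrite eqxx.
- apply: cM; apply: has_mean_sum => c _; apply: has_mean_sum => j _.
  exact: has_mean_sparse.
have [k12|k12] := boolP (12 <= k)%N; last first.
  rewrite mul0r; apply: eq_has_mean (has_mean0 P) => t.
  by rewrite mul0r.
apply: cM; apply: has_mean_sum => c _; apply: has_mean_sum => j jv.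
apply: has_mean_sum => l /andP[lv lj]; apply: has_mean_sum => i _.
have [a0 _] := step_radius_bound k12 (ltnW (ltn_ord i)).
have [a1 a1'] := step_radius_bound k12 (ltn_ord i).
have e1 := e0; have k0 : 0 <= k%:R :> R by [].
have ke : 0 <= k%:R * e by rewrite mulr_ge0// ltW.
apply: has_mean_twin => //.
- by apply: step_radius_homo.
- by rewrite -natr1; lra.
- lra.
- lra.
- by rewrite -natr1; lra.
Qed.

End mean.

End level_count.

(** * The bound at a fixed resolution *)

(** As [1 / (1 - y) = 1 + y / (1 - y) <= expR (y / (1 - y))]. *)
Lemma expR_le_pow (R : realType) (y : R) (n : nat) : 0 <= y < 1 ->
  expR (- (n%:R * y / (1 - y))) <= (1 - y) ^+ n.
Proof.
move=> /andP[y0 y1].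
have y1' : 0 < 1 - y by lra.
rewrite -mulrA -mulrN expRM_natl.
apply: lerXn2r; rewrite ?nnegrE ?expR_ge0 ?(ltW y1')//.
rewrite expRN -[leRHS]invrK lef_pV2 ?posrE ?expR_gt0 ?invr_gt0//.
apply: le_trans (expR_ge1Dx _); rewrite le_eqVlt; apply/orP; left; apply/eqP.
by field; rewrite gt_eqF.
Qed.

Lemma sumr_const_ord (R : comPzRingType) (n : nat) (a : R) : \sum_(i < n) a = n%:R * a.
Proof. by rewrite sumr_const card_ord [RHS]mulr_natl. Qed.

Section resolution.
Context (d : measure_display) (T : measurableType d) (R : realType)
  (P : probability T R) (X : nat -> {RV P >-> (R * R)%type}).
Hypothesis X_unif : forall i, uniform_on_unit_square (X i).
Hypothesis X_indep : mutually_independent X.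
Context (beta : R).
Hypothesis beta_lim : {ae P, forall t : T,
  (fun n : nat => shortest_tour_length (fun i : 'I_n => X i t)
                    / Num.sqrt (n%:R : R)) @ \oo --> beta}.
Context (q m : nat).
Hypothesis q0 : (0 < q)%N.
Hypothesis m0 : (0 < m)%N.

(** The number of points times the area of the disc of level [k], which does not
    depend on the number of points. *)
Definition disc_mean (k : nat) : R := pi * (k + 3)%:R ^+ 2 / q%:R ^+ 2.

(** The square of the number of points times [twin_density]. *)
Definition twin_mean (k : nat) : R := (12 <= k)%N%:R *
  (pi ^+ 2 * k%:R * (k%:R - 12) ^+ 3 / q%:R ^+ 4
    * ((m%:R - 1) * (2 * m%:R - 1) / (96 * m%:R ^+ 2))).

(** A lower bound for the mean count at level [k], up to the fraction of the square
    covered by cells; [y] is the inverse of the number of points. *)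
Definition level_limit (k : nat) (y : R) : R :=
  expR (- (disc_mean k / (1 - disc_mean k * y))) *
  (4 + 2 * (1 - y) * disc_mean k + (1 - y) * (1 - 2 * y) * twin_mean k).

(** The number of points is [side i ^ 2], so that the normalisation by the square
    root is rational. The offset in [side] makes the grid wider than its two
    margins. *)
Let s := (q ^ 2 + 3)%N.
Let side (i : nat) := (i + (2 * s + 2))%N.
Let mesh (i : nat) : R := ((side i * q)%:R)^-1.
Let cells (i : nat) := (side i * q - 2 * s)%N.

Let q0R : 0 < (q%:R : R). Proof. by rewrite ltr0n. Qed.
Let side0 i : 0 < ((side i)%:R : R). Proof. by rewrite ltr0n /side; lia. Qed.
Let mesh0 i : 0 < mesh i.
Proof. by rewrite invr_gt0 ltr0n muln_gt0 q0 andbT /side; lia. Qed.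

Let cells_mesh i : (cells i + 2 * s)%:R * mesh i <= 1.
Proof.
rewrite subnK ?divff//; last by rewrite /side; nia.
by rewrite pnatr_eq0 -lt0n muln_gt0 q0 andbT /side; lia.
Qed.

Lemma twin_mean_ge0 (k : nat) : 0 <= twin_mean k.
Proof.
rewrite /twin_mean; have [k12|k12] := boolP (12 <= k)%N; last by rewrite mul0r.
have kR : 12 <= k%:R :> R by rewrite ler_nat.
have mR : 1 <= m%:R :> R by rewrite ler1n.
by rewrite mul1r !mulr_ge0 ?invr_ge0 ?mulr_ge0 ?exprn_ge0 ?sqr_ge0 ?pi_ge0//; lra.
Qed.

Lemma disc_mean_mesh (i k : nat) :
  pi * (k.+1%:R * mesh i + 2 * mesh i) ^+ 2 = disc_mean k / (side i)%:R ^+ 2.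
Proof.
have s0 := side0 i; have q0' := q0R.
rewrite /disc_mean /mesh natrM natrD -natr1; field.
by rewrite !gt_eqF.
Qed.

Lemma disc_mean_small (i k : nat) : (k < q ^ 2)%N ->
  0 <= disc_mean k / (side i)%:R ^+ 2 < 1.
Proof.
move=> kq; have s0 := side0 i; have q0' := q0R.
(* The radius of a disc that fits into the unit square is at most [1 / 2]. *)
set x : R := (k + 3)%:R / (q%:R * (side i)%:R).
have -> : disc_mean k / (side i)%:R ^+ 2 = pi * x ^+ 2.
  by rewrite /disc_mean /x; field; rewrite !gt_eqF.
have x0 : 0 <= x by rewrite divr_ge0// mulr_ge0// ltW.
have x1 : x <= 1 / 2.
  rewrite ler_pdivrMr ?mulr_gt0// mulrC mulrA mulr1 ler_pdivlMr//.
  by rewrite -!natrM ler_nat /side /s; nia.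
have := pi_gt0 R; have := pihalf_lt2 R => p4 p0.
have xx : x ^+ 2 <= 1 / 4 by nra.
have := sqr_ge0 x => xx0.
by apply/andP; split; [exact: mulr_ge0 (ltW p0) xx0|nra].
Qed.

Lemma twin_mean_mesh (i k : nat) :
  twin_density m (mesh i) k = twin_mean k / (side i)%:R ^+ 4.
Proof.
have s0 := side0 i; have q0' := q0R.
have m0' : 0 < m%:R :> R by rewrite ltr0n.
rewrite /twin_density /twin_mean /mesh natrM; field.
by rewrite !gt_eqF.
Qed.

(** All powers of [1 - p] are bounded below by the [n]-th one. *)
Lemma level_mean_ge (i k n : nat) (p : R) : (k < q ^ 2)%N ->
  n = (side i ^ 2)%N -> p = pi * (k.+1%:R * mesh i + 2 * mesh i) ^+ 2 ->
  level_limit k ((side i)%:R ^-2) <=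
   4 * (1 - p) ^+ n.-1
      + 2 * n.-1%:R * p * (1 - p) ^+ n.-2
      + n.-1%:R * n.-2%:R * twin_density m (mesh i) k * (1 - p) ^+ (n - 3).
Proof.
move=> kq En Ep0.
have s0 := side0 i.
have n0 : 0 < (n%:R : R) by rewrite En natrX exprn_gt0.
have nE : n%:R = (side i)%:R ^+ 2 :> R by rewrite En natrX.
have Ep : p = disc_mean k / n%:R by rewrite Ep0 disc_mean_mesh nE.
have /andP[p0 p1] : 0 <= p < 1 by rewrite Ep nE disc_mean_small.
have p1' : 0 <= 1 - p by lra.
have pw j : (1 - p) ^+ n <= (1 - p) ^+ (n - j).
  by apply: ler_wiXn2l; [|lra|exact: leq_subr].
have n4 : (3 < n)%N by rewrite En /side; nia.
have t0 := twin_mean_ge0 k.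
have t1 : 0 <= twin_density m (mesh i) k.
  by rewrite twin_mean_mesh mulr_ge0// invr_ge0 exprn_ge0// ltW.
have n1E : n.-1%:R = n%:R - 1 :> R by rewrite -subn1 natrB//; move: n4; lia.
have n2E : n.-2%:R = n%:R - 2 :> R by rewrite -subn2 natrB//; move: n4; lia.
apply: le_trans (_ : (1 - p) ^+ n * (4 + 2 * n.-1%:R * p
   + n.-1%:R * n.-2%:R * twin_density m (mesh i) k) <= _); last first.
  rewrite [leLHS]mulrC mulrDl; apply: lerD; first (rewrite mulrDl; apply: lerD).
  - by apply: ler_wpM2l => //; rewrite -subn1.
  - by apply: ler_wpM2l; [apply: mulr_ge0 => //; apply: mulr_ge0 => //|have := pw 2; rewrite subn2].
  - by apply: ler_wpM2l; [apply: mulr_ge0 => //; apply: mulr_ge0 => //|exact: pw].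
rewrite /level_limit.
have -> : 2 * (1 - (side i)%:R ^-2) * disc_mean k = 2 * n.-1%:R * p.
  rewrite Ep n1E nE.
    by field; rewrite gt_eqF.
have -> : (1 - (side i)%:R ^-2) * (1 - 2 * (side i)%:R ^-2) * twin_mean k =
    n.-1%:R * n.-2%:R * twin_density m (mesh i) k.
  rewrite twin_mean_mesh n1E n2E nE.
  by field; rewrite gt_eqF.
apply: ler_wpM2r.
  by apply: addr_ge0; [apply: addr_ge0 => //|]; apply: mulr_ge0 => //; apply: mulr_ge0.
apply: le_trans (expR_le_pow n (_ : 0 <= p < 1)); last by rewrite p0.
by rewrite Ep mulrCA divff ?gt_eqF// mulr1 nE.
Qed.

Let Z (i : nat) (t : T) : R :=
  (\sum_(v < side i ^ 2) \sum_(k < q ^ 2)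
     level_count (cells i) s m (mesh i) v k (fun j => X j t) * mesh i)
  / (4 * (side i)%:R).

Let Y (i : nat) (t : T) : R :=
  shortest_tour_length (fun j : 'I_(side i ^ 2) => X j t)
    / Num.sqrt ((side i ^ 2)%:R : R).

Let e (i : nat) : R := ((cells i)%:R * mesh i) ^+ 2 *
  \sum_(k < q ^ 2) level_limit k ((side i)%:R ^-2) / (4 * q%:R).

Let ZY (i : nat) (t : T) : Z i t <= Y i t.
Proof.
have s0 := side0 i.
rewrite /Z /Y natrX sqrtr_sqr ger0_norm; last exact: ltW.
rewrite ler_pdivrMr ?mulr_gt0// mulrCA mulfVK ?gt_eqF//.
by apply: sum_level_count_le => //; rewrite /side; nia.
Qed.

Let Z_bound (i : nat) (t : T) : 0 <= Z i t <= 5 * (q ^ 2)%:R / (4 * q%:R).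
Proof.
have s0 := side0 i; have q0' := q0R; have h0 := mesh0 i.
apply/andP; split.
  rewrite divr_ge0 ?mulr_ge0 ?(ltW s0)// !sumr_ge0// => v _; rewrite sumr_ge0// => k _.
  by rewrite mulr_ge0 ?level_count_ge0// ltW.
apply: le_trans (_ : (\sum_(v < side i ^ 2) \sum_(k < q ^ 2) 5 * mesh i)
     / (4 * (side i)%:R) <= _).
  rewrite ler_wpM2r ?invr_ge0 ?mulr_ge0 ?(ltW s0)//.
  apply: ler_sum => v _; apply: ler_sum => k _.
  by rewrite ler_wpM2r ?(ltW h0)// level_count_le5.
rewrite !sumr_const_ord /mesh natrM natrX.
rewrite le_eqVlt; apply/orP; left; apply/eqP; rewrite natrX; field.
by rewrite !gt_eqF.
Qed.

Let mean (i : nat) : R := (\sum_(v < side i ^ 2) \sum_(k < q ^ 2)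
  (cells i * cells i)%:R * mesh i ^+ 2 *
   (4 * (1 - pi * (k.+1%:R * mesh i + 2 * mesh i) ^+ 2) ^+ (side i ^ 2).-1
   + 2 * (side i ^ 2).-1%:R * (pi * (k.+1%:R * mesh i + 2 * mesh i) ^+ 2) *
     (1 - pi * (k.+1%:R * mesh i + 2 * mesh i) ^+ 2) ^+ (side i ^ 2).-2
   + (side i ^ 2).-1%:R * (side i ^ 2).-2%:R * twin_density m (mesh i) k *
     (1 - pi * (k.+1%:R * mesh i + 2 * mesh i) ^+ 2) ^+ (side i ^ 2 - 3)) * mesh i)
  / (4 * (side i)%:R).

Let has_mean_Z (i : nat) : has_mean P (Z i) (mean i).
Proof.
apply: has_meanZ; apply: has_mean_sum => v _; apply: has_mean_sum => k _.
apply: has_meanZ; apply: has_mean_level_count => //.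
- by rewrite /s; have := ltn_ord k; lia.
- by rewrite /side; nia.
Qed.

Let e_le_mean (i : nat) : e i <= mean i.
Proof.
have s0 := side0 i; have q0' := q0R; have h0 := mesh0 i.
have hE : mesh i = ((side i)%:R * q%:R)^-1 by rewrite /mesh natrM.
have key (u w : R) : u <= w -> ((cells i)%:R * mesh i) ^+ 2 * (u / (4 * q%:R)) <=
    (side i ^ 2)%:R * ((cells i * cells i)%:R * mesh i ^+ 2 * w * mesh i) / (4 * (side i)%:R).
  move=> uw; have -> : (side i ^ 2)%:R * ((cells i * cells i)%:R * mesh i ^+ 2 * w * mesh i)
     / (4 * (side i)%:R) = ((cells i)%:R * mesh i) ^+ 2 * (w / (4 * q%:R)).
    by rewrite hE natrX natrM; field; rewrite !gt_eqF.
  by rewrite ler_wpM2l ?sqr_ge0// ler_wpM2r// invr_ge0 mulr_ge0// ltW.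
rewrite /mean sumr_const_ord mulr_sumr mulr_suml /e mulr_sumr.
by apply: ler_sum => k _; apply: key; exact: level_mean_ge.
Qed.

Let side_cvg : (fun i => (side i)%:R^-1 : R) @ \oo --> (0 : R).
Proof.
have pos : \forall i \near \oo, 0 < ((side i)%:R : R) by near=> i; exact: side0.
apply: ((gtr0_cvgV0 pos).2 _).
by apply: cvg_comp (cvg_addnr _) cvgr_idn.
Unshelve. all: by end_near. Qed.

Let cells_mesh_cvg : (fun i => ((cells i)%:R * mesh i) ^+ 2) @ \oo --> (1 : R).
Proof.
have E : (fun i => ((cells i)%:R * mesh i) ^+ 2) =
    (fun i => (1 - (2 * s)%:R / q%:R * (side i)%:R^-1) ^+ 2).
  apply/funext => i; congr (_ ^+ 2); have s0 := side0 i; have q0' := q0R.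
  rewrite /cells natrB; last by rewrite /side; nia.
  by rewrite /mesh natrM; field; rewrite !gt_eqF.
rewrite E -[X in _ --> X](_ : (1 - (2 * s)%:R / q%:R * 0) ^+ 2 = 1); last first.
  by rewrite mulr0 subr0 expr1n.
apply: (@cvg_comp _ _ _ _ (fun x : R => x ^+ 2)); last exact: exprn_continuous.
apply: cvgB; first exact: cvg_cst.
by apply: cvgM => //; exact: cvg_cst.
Qed.

Let level_limit_cvg (k : nat) :
  (fun i => level_limit k ((side i)%:R ^-2)) @ \oo --> level_limit k 0.
Proof.
have y0 : (fun i => (side i)%:R ^-2 : R) @ \oo --> (0 : R).
  rewrite (_ : (fun i => _) = (fun i => (side i)%:R^-1 * (side i)%:R^-1)); last first.
    by apply/funext => i; rewrite expr2 invfM.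
  by rewrite -[X in _ --> X](mulr0 0); exact: cvgM.
have cst (a : R) : (fun _ : nat => a) @ \oo --> a by exact: cvg_cst.
have lin (a : R) : (fun i => 1 - a * (side i)%:R ^-2 : R) @ \oo --> 1 - a * 0.
  by apply: cvgB => //; apply: cvgM.
have lin1 : (fun i => 1 - (side i)%:R ^-2 : R) @ \oo --> (1 - 0 : R) by apply: cvgB.
rewrite /level_limit; apply: cvgM.
  apply: continuous_cvg; first exact: continuous_expR.
  apply: cvgN; apply: cvgM => //.
  by apply: cvgV => //; rewrite mulr0 subr0 oner_neq0.
apply: cvgD; first apply: cvgD => //.
  by apply: cvgM => //; apply: cvgM.
by apply: cvgM => //; apply: cvgM.
Qed.

Lemma resolution_bound :
  \sum_(k < q ^ 2) level_limit k 0 / (4 * q%:R) <= beta.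
Proof.
apply: (mean_limit _ Z_bound ZY has_mean_Z e_le_mean).
  apply: filterS beta_lim => t; apply: cvg_comp.
  apply/cvgnyPge => A; near=> i.
  have : (A <= i)%N by near: i; exact: nbhs_infty_ge.
  by rewrite /side; nia.
rewrite -[X in _ --> X]mul1r; apply: cvgM => //.
rewrite -mulr_suml; under eq_fun do rewrite -mulr_suml.
apply: cvgM; last exact: cvg_cst.
elim: (q ^ 2)%N => [|K IH].
  by rewrite big_ord0; under eq_fun do rewrite big_ord0; exact: cvg_cst.
rewrite big_ord_recr; under eq_fun do rewrite big_ord_recr.
by apply: cvgD.
Unshelve. all: by end_near. Qed.

End resolution.

(** * Riemann sums of a Gaussian times a quartic *)

Section gaussian_riemann_sum.
Context (R : realType).
Variable (c : R).
Hypothesis c01 : 0 <= c <= 1 / 4.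
Notation I := (@gauss_integral_proof.integral0_gauss R).

(** Here [x ^+ 2] is the mean number of points in a disc of scaled radius
    [x / sqrt pi]. *)
Definition quartic_gauss (x : R) : R :=
  gauss_fun x * (1 + x ^+ 2 / 2 + c * x ^+ 4).

Let total : R := 5 / 8 + 3 / 8 * c.

(** Found by integrating [x ^+ 2 * expR (- x ^+ 2)] and [x ^+ 4 * expR (- x ^+ 2)]
    by parts. *)
Definition quartic_gauss_primitive (x : R) : R :=
  2 * total * I x - ((1 / 4 + 3 / 4 * c) * x + c / 2 * x ^+ 3) * gauss_fun x.
Notation H := quartic_gauss_primitive.

(** With [w = y ^+ 2 - x ^+ 2], the bound [(1 + w / 2) ^+ 2 <= expR w] is enough
    because the quartic coefficient is at most [1 / 4]. *)
Lemma quartic_gauss_decr (x y : R) : 0 <= x -> x <= y ->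
  quartic_gauss y <= quartic_gauss x.
Proof.
move=> x0 xy; have y0 := le_trans x0 xy.
have [c0 c1] := andP c01.
rewrite /quartic_gauss /gauss_fun.
have -> : x ^+ 4 = (x ^+ 2) ^+ 2 by ring.
have -> : y ^+ 4 = (y ^+ 2) ^+ 2 by ring.
have : x ^+ 2 <= y ^+ 2 by rewrite ler_pXn2r.
have := sqr_ge0 x; set u := x ^+ 2; set v := y ^+ 2 => u0 uv.
have -> : - u = - v + (v - u) by ring.
rewrite expRD -mulrA ler_wpM2l ?expR_ge0//.
have -> : v = u + (v - u) by ring.
have := subr_ge0 u v; rewrite uv; set w := v - u => w0.
have -> : u + w - u = w by ring.
apply: le_trans (_ : (1 + w / 2) ^+ 2 * (1 + u / 2 + c * u ^+ 2) <= _).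
  have cu : 0 <= c * u by rewrite mulr_ge0.
  have : 0 <= c * u * (u * w ^+ 2) by rewrite !mulr_ge0 ?sqr_ge0.
  have : 0 <= c * u * (u * w) by rewrite !mulr_ge0.
  have : 0 <= u * w ^+ 2 by rewrite mulr_ge0 ?sqr_ge0.
  have : 0 <= (1 / 4 - c) * w ^+ 2 by rewrite mulr_ge0 ?sqr_ge0//; lra.
  have : 0 <= (1 / 4 - c) * (u * w) by rewrite !mulr_ge0//; lra.
  nra.
have -> : w = w / 2 + w / 2 by field.
rewrite [in expR _]expRD -expr2 ler_wpM2r//.
  by rewrite !addr_ge0 ?mulr_ge0 ?sqr_ge0//; lra.
by have := expR_ge1Dx (w / 2) => ?; rewrite ler_pXn2r ?nnegrE ?expR_ge0//; lra.
Qed.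

Lemma is_derive_integral0_gauss (x : R) : 0 < x ->
  is_derive x (1 : R) I (gauss_fun x).
Proof.
move=> x0.
have [dI EI] : derivable I x 1 /\ derive1 I x = gauss_fun x.
  apply: (@continuous_FTC1 R gauss_fun (BLeft 0) _ (x + 1) _ _ _ _).
  - by rewrite ltrDl.
  - apply: continuous_compact_integrable => //; first exact: segment_compact.
    by apply: continuous_subspaceT; exact: continuous_gauss_fun.
  - by rewrite /=; rewrite lte_fin.
  - by move=> ?; exact: continuous_gauss_fun.
by apply: DeriveDef => //; rewrite -derive1E.
Qed.

Lemma is_derive_quartic_gauss_primitive (x : R) : 0 < x ->
  is_derive x (1 : R) H (quartic_gauss x).
Proof.
move=> x0; have dI := is_derive_integral0_gauss x0.
have dg : is_derive x (1 : R) gauss_fun (- 2 * x * gauss_fun x).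
  by rewrite /gauss_fun; apply: is_derive_eq; rewrite /GRing.scale /=; ring.
rewrite /H /quartic_gauss; apply: is_derive_eq.
by rewrite /GRing.scale /= /total; field.
Qed.

(** By the mean value theorem on each step, as the integrand is decreasing. *)
Lemma riemann_sum_ge (h : R) (j K : nat) : 0 < h -> (0 < j)%N ->
  H ((K + j)%:R * h) - H (j%:R * h) <=
    h * \sum_(k < K) quartic_gauss ((k + j)%:R * h).
Proof.
move=> h0 j0; elim: K => [|K IH]; first by rewrite big_ord0 mulr0 add0n subrr.
rewrite big_ord_recr /= mulrDr.
have x0 : 0 < (K + j)%:R * h by rewrite mulr_gt0// ltr0n addn_gt0 j0 orbT.
set x := (K + j)%:R * h in IH x0 *.
have -> : (K.+1 + j)%:R * h = x + h by rewrite addSn -natr1 mulrDl mul1r.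
have dH y : x <= y -> is_derive y (1 : R) H (quartic_gauss y).
  by move=> xy; apply: is_derive_quartic_gauss_primitive; exact: lt_le_trans xy.
have [|z zI||z zI E] := @MVT R H quartic_gauss x (x + h).
- by rewrite ltrDl.
- by apply: dH; move: zI; rewrite in_itv/= => /andP[/ltW].
- apply: derivable_within_continuous => y; rewrite in_itv/= => /andP[xy _].
  by have [] := dH _ xy.
have : quartic_gauss z <= quartic_gauss x.
  by apply: quartic_gauss_decr; [exact: ltW|move: zI; rewrite in_itv/= => /andP[/ltW]].
move=> /(ler_wpM2l (ltW h0)); move: E.
have -> : x + h - x = h by ring.
by rewrite (mulrC h (quartic_gauss x)); lra.
Qed.

Lemma integral0_gauss_le (x : R) : 0 <= x -> I x <= x.
Proof.
move=> x0.
apply: le_trans (_ : \int[lebesgue_measure]_(t in `[0%R, x]) 1 <= _).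
  apply: le_Rintegral => //.
  - apply: continuous_compact_integrable => //; first exact: segment_compact.
    by apply: continuous_subspaceT; exact: continuous_gauss_fun.
  - apply: continuous_compact_integrable => //; first exact: segment_compact.
    by apply: continuous_subspaceT => ?; exact: cvg_cst.
  - by move=> t _; exact: gauss_fun_le1.
rewrite Rintegral_cst// mul1r.
rewrite [X in fine X](_ : _ = x%:E)//.
transitivity (@lebesgue_measure R `[0%R, x]%classic) => //.
rewrite lebesgue_measure_itv /= lte_fin; case: ltP => [_|x0']; first by rewrite sube0.
by congr EFin; apply: le_anti; rewrite x0 x0'.
Qed.

Lemma cvg_integral0_gauss : I x @[x --> +oo] --> Num.sqrt pi / 2.
Proof.
have : Num.sqrt (I x ^+ 2) @[x --> +oo] --> Num.sqrt (pi / 4).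
  by apply: continuous_cvg; [exact: sqrt_continuous|
    exact: gauss_integral_proof.cvg_integral0_gauss_sqr].
rewrite (_ : 4 = 2 ^+ 2); last by rewrite expr2 -natrM.
rewrite sqrtrM ?pi_ge0// sqrtrV// sqrtr_sqr ger0_norm//.
rewrite (_ : (fun x => Num.sqrt (I x ^+ 2)) = I)//; apply/funext => x.
by rewrite sqrtr_sqr ger0_norm// gauss_integral_proof.integral0_gauss_ge0.
Qed.

Lemma primitive_le (x : R) : 0 <= x -> H x <= 2 * total * x.
Proof.
move=> x0; have [c0 c1] := andP c01.
apply: le_trans (_ : 2 * total * I x <= _).
  rewrite lerBlDr lerDl mulr_ge0 ?expR_ge0// !addr_ge0// !mulr_ge0 ?exprn_ge0//; lra.
by rewrite ler_wpM2l ?integral0_gauss_le// /total; lra.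
Qed.

(** From [expR (x ^+ 2) >= x ^+ 4 / 4]. *)
Lemma primitive_ge (x : R) : 1 <= x -> 2 * total * I x - 4 / x <= H x.
Proof.
move=> x1; have [c0 c1] := andP c01; have x0 : 0 < x by lra.
rewrite lerD2l lerNr opprK.
have g : gauss_fun x <= 4 / x ^+ 4.
  rewrite /gauss_fun expRN -[leRHS]invf_div lef_pV2 ?posrE ?expR_gt0 ?divr_gt0 ?exprn_gt0//.
  have -> : x ^+ 2 = x ^+ 2 / 2 + x ^+ 2 / 2 by field.
  rewrite expRD; have := expR_ge1Dx (x ^+ 2 / 2).
  have -> : x ^+ 4 / 4 = (x ^+ 2 / 2) * (x ^+ 2 / 2) by field.
  have : 0 <= x ^+ 2 / 2 by rewrite divr_ge0 ?sqr_ge0.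
  by move=> ? ?; apply: ler_pM => //; lra.
apply: le_trans (ler_wpM2l _ g) _.
  rewrite !addr_ge0// !mulr_ge0 ?exprn_ge0//; lra.
have x13 : x <= x ^+ 3 by rewrite ler_eXnr.
rewrite mulrA ler_pdivrMr ?exprn_gt0//.
have -> : 4 / x * x ^+ 4 = 4 * x ^+ 3 by field; lra.
rewrite mulrC ler_wpM2l//.
have : 0 <= x ^+ 3 by apply: exprn_ge0; lra.
nra.
Qed.

(** The number [q ^ 2] of terms makes the range of integration grow like [q] while
    the step shrinks like [1 / q], so that a single limit suffices. The shift by
    [3] and the error [C / q] vanish in the limit. *)
Lemma riemann_limit (b C : R) :
  (forall q : nat, (0 < q)%N ->
     (\sum_(k < q ^ 2) quartic_gauss ((k + 3)%:R * (Num.sqrt pi / q%:R))) / q%:R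
       - C / q%:R <= b) ->
  total <= b.
Proof.
move=> Hb; have [c0 c1] := andP c01.
have sp0 : 0 < Num.sqrt pi :> R by rewrite sqrtr_gt0 pi_gt0.
set sp := Num.sqrt pi in Hb sp0.
have sp1 : 1 <= sp.
  by rewrite -sqrtr1 ler_wsqrtr//; apply: le_trans (pi_ge2 R); rewrite ler1n.
pose X (q : nat) : R := (q ^ 2 + 3)%:R * (sp / q%:R).
have qX (q : nat) : (0 < q)%N -> q%:R <= X q.
  move=> q0; have q0' : 0 < q%:R :> R by rewrite ltr0n.
  rewrite /X natrD natrX mulrDl; apply: le_trans (_ : q%:R * sp <= _).
    by rewrite ler_peMr// ltW.
  have -> : q%:R ^+ 2 * (sp / q%:R) = q%:R * sp by field; rewrite gt_eqF.
  by rewrite lerDl !mulr_ge0 ?invr_ge0 ?ltW.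
pose D : R := (4 + 6 * total * sp) / sp + C.
pose lo (q : nat) : R := 2 * total * I (X q) / sp - D * q%:R^-1.
have lob (q : nat) : (0 < q)%N -> lo q <= b.
  move=> q0; have q0' : 0 < q%:R :> R by rewrite ltr0n.
  have q1 : 1 <= q%:R :> R by rewrite ler1n.
  apply: le_trans (Hb q q0); set S := \sum_(_ < _) _.
  have h0 : 0 < sp / q%:R by rewrite divr_gt0.
  have := @riemann_sum_ge (sp / q%:R) 3 (q ^ 2) h0 isT; rewrite -/S -/(X q).
  have X1 : 1 <= X q by apply: le_trans (qX _ q0).
  have := primitive_ge X1.
  have h3 : 0 <= 3%:R * (sp / q%:R) by rewrite mulr_ge0// ltW.
  have := primitive_le h3.
  have : 4 / X q <= 4 / q%:R.
    by rewrite ler_pM2l// lef_pV2 ?posrE ?qX//; lra.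
  move=> a1 a2 a3 a4.
  have : 2 * total * I (X q) - 4 / q%:R - 2 * total * (3 * (sp / q%:R))
      <= sp / q%:R * S by lra.
  rewrite -(ler_pM2r (_ : 0 < sp^-1)) ?invr_gt0// => a5.
  have -> : S / q%:R = sp / q%:R * S / sp by field; rewrite !gt_eqF.
  apply: le_trans (lerD a5 (lexx _)); rewrite /lo /D le_eqVlt; apply/orP; left.
  by apply/eqP; field; rewrite !gt_eqF.
have inv0 : (fun q : nat => q%:R^-1 : R) @ \oo --> (0 : R).
  have pos : \forall q \near \oo, 0 < (q%:R : R).
    by near=> q; rewrite ltr0n; near: q; exact: nbhs_infty_gt.
  exact: ((gtr0_cvgV0 pos).2 cvgr_idn).
have Xy : X @ \oo --> +oo.
  apply: ger_cvgy cvgr_idn; near=> q; apply: qX; near: q; exact: nbhs_infty_gt.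
have loT : lo @ \oo --> 2 * total * (sp / 2) / sp - D * 0.
  apply: cvgB; last by apply: cvgM => //; exact: cvg_cst.
  apply: cvgM; last exact: cvg_cst.
  apply: cvgM; first exact: cvg_cst.
  exact: cvg_comp Xy cvg_integral0_gauss.
have <- : 2 * total * (sp / 2) / sp - D * 0 = total by field; rewrite gt_eqF.
apply: ler_cvg_to loT (cvg_cst b) _.
by near=> q; apply: lob; near: q; exact: nbhs_infty_gt.
Unshelve. all: by end_near. Qed.

End gaussian_riemann_sum.

(** * Conclusion *)

(** From level [2000] on, the staircase of [50] steps, shortened by the width of the
    cells, still has the required area. Each lower level costs at most [1]. *)
Lemma quartic_gauss_le_level (R : realType) (q k : nat) : (0 < q)%N ->
  quartic_gauss (19 / 3888) ((k + 3)%:R * (Num.sqrt pi / q%:R))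
    <= level_limit q 50 k (0 : R) / 4 + (k < 2000)%N%:R.
Proof.
move=> q0; have q0' : 0 < q%:R :> R by rewrite ltr0n.
rewrite /quartic_gauss /gauss_fun /level_limit.
have -> : ((k + 3)%:R * (Num.sqrt pi / q%:R)) ^+ 4 =
   (((k + 3)%:R * (Num.sqrt pi / q%:R)) ^+ 2) ^+ 2 :> R by ring.
have -> : ((k + 3)%:R * (Num.sqrt pi / q%:R)) ^+ 2 = disc_mean R q k.
  by rewrite !exprMn exprVn sqr_sqrtr ?pi_ge0// /disc_mean; ring.
have tw0 : 0 <= twin_mean R q 50 k by exact: twin_mean_ge0.
have u0 : 0 <= disc_mean R q k.
  by rewrite divr_ge0 ?mulr_ge0 ?sqr_ge0 ?pi_ge0.
set u := disc_mean R q k in u0 *.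
rewrite mulr0 !subr0 !mulr1 mul1r divr1.
have e0 := expR_ge0 (- u).
have [k2|k2] := ltnP k 2000.
  have eu : expR (- u) * u ^+ 2 <= 4.
    have E : expR (- u) * (expR (u / 2) * expR (u / 2)) = 1.
      by rewrite -!expRD -[RHS](expR0 R); congr expR; field.
    have h : u / 2 <= expR (u / 2) by apply: le_trans (expR_ge1Dx _); lra.
    have : u / 2 * (u / 2) <= expR (u / 2) * expR (u / 2) by apply: ler_pM => //; lra.
    by move=> /(ler_wpM2l e0); rewrite E; lra.
  have : 0 <= expR (- u) * twin_mean R q 50 k by rewrite mulr_ge0.
  by rewrite /=; lra.
rewrite addr0.
have tw : 4 * (19 / 3888) * u ^+ 2 <= twin_mean R q 50 k.
  rewrite /twin_mean (leq_trans _ k2)// mul1r /u /disc_mean natrD.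
  (* All coefficients in [y] of the difference of the two sides are positive. *)
  set y : R := k%:R - 2000.
  have y0 : 0 <= y by rewrite subr_ge0 ler_nat.
  have -> : k%:R = y + 2000 :> R by rewrite /y; ring.
  have -> : 4 * (19 / 3888) * (pi * (y + 2000 + 3) ^+ 2 / q%:R ^+ 2) ^+ 2 =
      pi ^+ 2 / q%:R ^+ 4 * (4 * (19 / 3888) * (y + 2003) ^+ 4) :> R.
    by field; rewrite gt_eqF.
  have -> : pi ^+ 2 * (y + 2000) * (y + 2000 - 12) ^+ 3 / q%:R ^+ 4 *
     ((50 - 1) * (2 * 50 - 1) / (96 * 50 ^+ 2)) =
     pi ^+ 2 / q%:R ^+ 4 * ((y + 2000) * (y + 1988) ^+ 3 * (4851 / (960 * 250))) :> R.
    by field; rewrite gt_eqF.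
  rewrite ler_wpM2l ?divr_ge0 ?exprn_ge0 ?pi_ge0 ?(ltW q0')//.
  have := exprn_ge0 2 y0; have := exprn_ge0 3 y0; have := exprn_ge0 4 y0.
  lra.
have := ler_wpM2l e0 tw; lra.
Qed.

Theorem theorem3 (R : realType) (d : measure_display) (T : measurableType d)
    (P : probability T R) (X : nat -> {RV P >-> (R * R)%type})
    (X_unif : forall i : nat, uniform_on_unit_square (X i))
    (X_indep : mutually_independent X)
    (beta : R)
    (beta_lim : {ae P, forall t : T,
       (fun n : nat => shortest_tour_length (fun i : 'I_n => X i t)
                         / Num.sqrt (n%:R : R)) @ \oo --> beta}) :
  5 / 8 + 19 / 10368 <= beta.
Proof.
have -> : 5 / 8 + 19 / 10368 = 5 / 8 + 3 / 8 * (19 / 3888) :> R by field.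
apply: (@riemann_limit R (19 / 3888) _ beta 2000); first by apply/andP; split; lra.
move=> q q0; have q0' : 0 < q%:R :> R by rewrite ltr0n.
apply: le_trans (resolution_bound X_unif X_indep beta_lim q0 (isT : (0 < 50)%N)).
pose f (k : nat) : R := quartic_gauss (19 / 3888) ((k + 3)%:R * (Num.sqrt pi / q%:R)).
have cnt : (\sum_(k < q ^ 2) (k < 2000)%N = minn (q ^ 2) 2000)%N.
  elim: (q ^ 2)%N => [|K IH]; first by rewrite big_ord0 min0n.
  by rewrite big_ord_recr /= IH; lia.
have fle : \sum_(k < q ^ 2) f k <= (\sum_(k < q ^ 2) level_limit q 50 k (0 : R)) / 4 + 2000.
  apply: le_trans (_ : \sum_(k < q ^ 2)
      (level_limit q 50 k (0 : R) / 4 + (k < 2000)%N%:R) <= _).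
    by apply: ler_sum => k _; exact: quartic_gauss_le_level.
  by rewrite big_split /= -mulr_suml lerD2l -natr_sum cnt ler_nat geq_minr.
rewrite -mulr_suml -mulrBl invfM mulrA ler_wpM2r ?invr_ge0 ?(ltW q0')//.
by rewrite lerBlDr.
Qed.
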